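(* Let $\mathbb K$ be $\mathbb C$ or $\mathbb R$ and let $(\mathfrak g,\delta)$ be a semisimple Lie bialgebra over $\mathbb K$ which is factorizable or, when $\mathbb K=\mathbb R$, factorizable or almost factorizable. Put $\mathfrak g_{\mathbb C}=\mathfrak g$ if $\mathbb K=\mathbb C$ and $\mathfrak g_{\mathbb C}=\mathfrak g\otimes_{\mathbb R}\mathbb C$ if $\mathbb K=\mathbb R$, and suppose that the cobracket on $\mathfrak g_{\mathbb C}$ (that is, $\delta$, respectively $\delta\otimes_{\mathbb R}\mathrm{id}_{\mathbb C}$) is $x\mapsto\mathrm{ad}_x(r)$, where $r\in\mathfrak g_{\mathbb C}\otimes\mathfrak g_{\mathbb C}$ is a Belavin–Drinfeld classical r-matrix with Cartan subalgebra $\mathfrak h\subset\mathfrak g_{\mathbb C}$ and Belavin–Drinfeld triple $(\Gamma_1,\Gamma_2,\tau)$. If $D\colon\mathfrak g\to\mathfrak g$ is a biderivation, then $D=\mathrm{ad}_H$ for a unique $H\in\mathfrak h\cap\mathfrak g$, and it satisfies $$\alpha(H)=(\tau\alpha)(H)\quad\text{for all }\alpha\in\Gamma_1.$$ In particular, if the discrete parameter $(\Gamma_1,\Gamma_2,\tau)$ is empty, then any $H\in\mathfrak h\cap\mathfrak g$ determines a biderivation $\mathrm{ad}_H$, and all biderivations are of this type.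
   Context: A Lie bialgebra is a Lie algebra $\mathfrak g$ with a linear map $\delta\colon\mathfrak g\to\Lambda^2\mathfrak g$ satisfying co-Jacobi and the 1-cocycle condition $\delta[x,y]=\mathrm{ad}_x\delta(y)-\mathrm{ad}_y\delta(x)$. A biderivation is a linear map $D\colon\mathfrak g\to\mathfrak g$ that is a derivation and a coderivation, i.e. $(D\otimes\mathrm{id}+\mathrm{id}\otimes D)\delta=\delta D$. $(\mathfrak g,\delta)$ is factorizable if there is $r\in\mathfrak g\otimes\mathfrak g$ with $\delta(x)=\mathrm{ad}_x(r)$ for all $x$, $[r^{12},r^{13}]+[r^{12},r^{23}]+[r^{13},r^{23}]=0$ (CYBE), and whose symmetric component induces a nondegenerate inner product on $\mathfrak g^*$. A real Lie bialgebra is almost factorizable if it is not factorizable but its complexification $(\mathfrak g\otimes_{\mathbb R}\mathbb C,\delta\otimes_{\mathbb R}\mathrm{id}_{\mathbb C})$ is factorizable. Semisimple Lie algebras are finite dimensional. Belavin–Drinfeld classical r-matrix on a complex semisimple Lie algebra $\mathfrak a$: fix a nondegenerate symmetric invariant bilinear form $(-,-)$ on $\mathfrak a$ with Casimir element $\Omega\in(S^2\mathfrak a)^{\mathfrak a}$, a Cartan subalgebra $\mathfrak h$, with root system $\Phi$, positive roots $\Phi^+$ and simple roots $\Delta$. A BD-triple $(\Gamma_1,\Gamma_2,\tau)$ consists of subsets $\Gamma_1,\Gamma_2\subseteq\Delta$ and a bijection $\tau\colon\Gamma_1\to\Gamma_2$ preserving the inner product such that for each $\alpha\in\Gamma_1$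 there is a positive integer $n$ with $\tau^n(\alpha)\in\Gamma_2\setminus\Gamma_1$. Let $\widetilde\Gamma_i$ be the set of positive roots in the subgroup generated by $\Gamma_i$; extending $\tau$ additively, write $\alpha\prec\beta$ if $\alpha\in\widetilde\Gamma_1$, $\beta\in\widetilde\Gamma_2$ and $\beta=\tau^n(\alpha)$ for some positive integer $n$. A continuous parameter is $r_0\in\mathfrak h\otimes\mathfrak h$ with $(\tau(\alpha)\otimes\mathrm{id}+\mathrm{id}\otimes\alpha)r_0=0$ for all $\alpha\in\Gamma_1$ and $r_0+r_0^{21}=\Omega_0$, the $\mathfrak h\otimes\mathfrak h$-component of $\Omega$. Then $$r=r_0+\sum_{\alpha\in\Phi^+}x_{-\alpha}\otimes x_\alpha+\sum_{\alpha\in\Phi^+:\ \alpha\prec\beta}(x_{-\alpha}\otimes x_\beta-x_\beta\otimes x_{-\alpha}),$$ where $x_{\pm\alpha}\in\mathfrak a_{\pm\alpha}$ are root vectors with $(x_\alpha,x_{-\alpha})=1$. *)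

(* Defs.v *)
From HB Require Import structures.
From mathcomp Require Import all_boot all_order all_algebra.
From mathcomp Require Import ring complex.
From mathcomp Require Import boolp reals.

Set Implicit Arguments.
Unset Strict Implicit.
Unset Printing Implicit Defensive.

Import Order.TTheory GRing.Theory Num.Theory.
Local Open Scope ring_scope.

Section Tensor.
Variable K : fieldType.
Implicit Types U V W : vectType K.

(* [V ⊗ W] is modelled by the coordinate matrices in the bases
   [vbasis fullv] of [V] and [W]; [tensE] and [tliftE] below give the
   universal property, so that the choice of bases is immaterial. *)
Definition tens V W : vectType K := 'M[K]_(\dim {:V}, \dim {:W}).

Definition pure V W (v : V) (w : W) : tens V W :=
  \matrix_(i, j) (coord (vbasis {:V}) i v * coord (vbasis {:W}) j w).

(* For [b] bilinear, the linear map [V ⊗ W -> U] induced by [b]. *)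
Definition tlift V W U (b : V -> W -> U) (t : tens V W) : U :=
  \sum_i \sum_j (t : 'M[K]_(_, _)) i j *: b (vbasis {:V})`_i (vbasis {:W})`_j.

Definition tmap V W V' W' (f : V -> V') (g : W -> W') :
  tens V W -> tens V' W' := tlift (fun v w => pure (f v) (g w)).

Definition tswap V W : tens V W -> tens W V := tlift (fun v w => pure w v).

(* [a ⊗ (b ⊗ c) |-> b ⊗ (c ⊗ a)] *)
Definition tcycle V : tens V (tens V V) -> tens V (tens V V) :=
  tlift (fun a => tlift (fun b c => pure b (pure c a))).

(* [D ⊗ id + id ⊗ D] *)
Definition tder V (D : V -> V) : tens V V -> tens V V :=
  tlift (fun v w => pure (D v) w + pure v (D w)).

Lemma eq_coord V (v w : V) :
  (forall i, coord (vbasis {:V}) i v = coord (vbasis {:V}) i w) -> v = w.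
Proof.
move=> eq_vw; rewrite (coord_vbasis (memvf v)) (coord_vbasis (memvf w)).
by apply: eq_bigr => i _; rewrite eq_vw.
Qed.

Lemma tensE V W (t : tens V W) : t = tlift (@pure V W) t.
Proof.
rewrite /tlift; apply/matrixP => k l; rewrite summxE (bigD1 k) //=.
rewrite summxE (bigD1 l) //= !mxE !coord_free ?(basis_free (vbasisP _)) //.
rewrite !eqxx !mulr1 !big1 ?addr0 // => [i nik|j njl].
  rewrite summxE big1 // => j _; rewrite !mxE coord_free ?(basis_free (vbasisP _)) //.
  by rewrite (negPf nik) mul0r mulr0.
rewrite !mxE [X in _ * (_ * X)]coord_free ?(basis_free (vbasisP _)) //.
by rewrite (negPf njl) !mulr0.
Qed.

Lemma tliftE V W U (b : V -> W -> U) v w :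
  (forall w', linear (b^~ w')) -> (forall v', linear (b v')) ->
  tlift b (pure v w) = b v w.
Proof.
move=> bl br.
pose bL w' := GRing.isLinear.Build K V U _ (b^~ w') (bl w').
pose fL w' : {linear V -> U} := HB.pack (b^~ w') (bL w').
pose bR v' := GRing.isLinear.Build K W U _ (b v') (br v').
pose fR v' : {linear W -> U} := HB.pack (b v') (bR v').
rewrite /tlift {2}(coord_vbasis (memvf v)) -[RHS]/(fL w _) linear_sum /=.
apply: eq_bigr => i _; rewrite -[RHS]/(fL w _) linearZ /=.
rewrite {2}(coord_vbasis (memvf w)) -[X in _ = _ *: X]/(fR _ _).
rewrite linear_sum scaler_sumr; apply: eq_bigr => j _.
by rewrite mxE linearZ /= scalerA.
Qed.

End Tensor.

HB.mixin Record Vector_isLieAlgebra (K : fieldType) g of Vector K g := {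
  lie : g -> g -> g;
  lie_linearl : forall y, linear (lie^~ y);
  lie_linearr : forall x, linear (lie x);
  liexx : forall x, lie x x = 0;
  lie_jacobi : forall x y z,
    lie x (lie y z) + lie y (lie z x) + lie z (lie x y) = 0
}.

#[short(type="lieAlgType")]
HB.structure Definition LieAlgebra (K : fieldType) :=
  { g of Vector K g & Vector_isLieAlgebra K g }.

Section LieTheory.
Variables (K : fieldType) (g : lieAlgType K).
Implicit Types (x y : g) (U V I : {vspace g}).

HB.instance Definition _ x :=
  GRing.isLinear.Build K g g _ (lie x) (lie_linearr x).

Definition ad x : 'End(g) := linfun (lie x).

Definition tad x : tens g g -> tens g g := tder (lie x).

Definition lie_ideal I := forall x y, y \in I -> lie x y \in I.

Definition lie_prod U V : {vspace g} :=
  <<[seq lie x y | x <- vbasis U, y <- vbasis V]>>%VS.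

Definition lie_solvable U :=
  exists n, iter n (fun V => lie_prod V V) U = 0%VS.

Definition semisimple := forall I, lie_ideal I -> lie_solvable I -> I = 0%VS.

Definition derivation (D : 'End(g)) :=
  forall x y, D (lie x y) = lie (D x) y + lie x (D y).

(* In characteristic different from 2, [Λ² g] is the space of
   skew-symmetric tensors in [g ⊗ g]. *)
Record lie_bialgebra (delta : 'Hom(g, tens g g)) : Prop := {
  cobracket_skew : forall x, tswap (delta x) = - delta x;
  cobracket_cojacobi : forall x, let t := tmap id delta (delta x) in
    t + tcycle t + tcycle (tcycle t) = 0;
  cobracket_cocycle : forall x y,
    delta (lie x y) = tad x (delta y) - tad y (delta x)
}.

Definition biderivation (delta : 'Hom(g, tens g g)) (D : 'End(g)) :=
  derivation D /\ forall x, tder D (delta x) = delta (D x).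

(* [ [r12, r13] + [r12, r23] + [r13, r23] ], where [a ⊗ b] and [c ⊗ d] are
   terms of the first and the second copy of [r]. *)
Definition cybe_lhs (r : tens g g) : tens g (tens g g) :=
  tlift (fun a b => tlift (fun c d =>
    pure (lie a c) (pure b d) + pure a (pure (lie b c) d)
    + pure a (pure c (lie b d))) r) r.

(* The bilinear form [(phi, psi) |-> (phi ⊗ psi) t] on the dual of [g]. *)
Definition tform (t : tens g g) (phi psi : 'Hom(g, K^o)) : K :=
  tlift (fun x y => phi x * psi y : K^o) t.

Definition symmetric_part (r : tens g g) : tens g g := 2^-1 *: (r + tswap r).

Definition factorizable (delta : g -> tens g g) :=
  exists r : tens g g,
    [/\ forall x, delta x = tad x r,
        cybe_lhs r = 0
      & forall phi, (forall psi, tform (symmetric_part r) phi psi = 0) ->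
          phi = 0].

End LieTheory.

Section Complexification.
Variable R : rcfType.

(* [V ⊗_R C]; the pair [(x, y)] stands for [x ⊗ 1 + y ⊗ i]. *)
Definition cplx (V : vectType R) : Type := (V * V)%type.

Section Vect.
Variable V : vectType R.

HB.instance Definition _ := GRing.Zmodule.copy (cplx V) (V * V)%type.

Definition cplx_scale (z : R[i]) (v : cplx V) : cplx V :=
  (complex.Re z *: v.1 - complex.Im z *: v.2,
   complex.Re z *: v.2 + complex.Im z *: v.1).

Fact cplx_scaleA a b v :
  cplx_scale a (cplx_scale b v) = cplx_scale (a * b) v.
Proof.
case: a b v => [a a'] [b b'] [x y]; congr pair; apply: eq_coord => i /=;
  rewrite !(linearD, linearN, linearZ) /=; ring.
Qed.

Fact cplx_scale1 : left_id 1 cplx_scale.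
Proof. by case=> x y; rewrite /cplx_scale /= !scale1r !scale0r subr0 addr0. Qed.

Fact cplx_scaleDr : right_distributive cplx_scale +%R.
Proof.
case=> a b [x y] [x' y']; congr pair; rewrite /= !scalerDr.
  by rewrite opprD addrACA.
by rewrite addrACA.
Qed.

Fact cplx_scaleDl v : {morph cplx_scale^~ v : a b / a + b}.
Proof.
case: v => x y [a a'] [b b']; congr pair; rewrite /= !scalerDl.
  by rewrite opprD addrACA.
by rewrite addrACA.
Qed.

HB.instance Definition _ := GRing.Zmodule_isLmodule.Build R[i] (cplx V)
  cplx_scaleA cplx_scale1 cplx_scaleDr cplx_scaleDl.

Let e := vbasis {:V}.

Definition cplx_coord (v : cplx V) : 'rV[R[i]]_(\dim {:V}) :=
  \row_i Complex (coord e i v.1) (coord e i v.2).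

Fact cplx_vector_axiom : Vector.axiom (\dim {:V}) (cplx V).
Proof.
exists cplx_coord => [z v w|].
  apply/rowP => i; rewrite !mxE /= !linearD /= linearN /= !linearZ /=.
  by apply/eqP; rewrite eq_complex; case: z => a b /=; rewrite !eqxx.
pose inv (r : 'rV[R[i]]_(\dim {:V})) : cplx V :=
  (\sum_i complex.Re (r 0 i) *: e`_i, \sum_i complex.Im (r 0 i) *: e`_i).
exists inv => [[x y]|r].
  rewrite /inv /cplx_coord; congr pair.
    by rewrite [RHS](coord_vbasis (memvf x)); apply: eq_bigr => i _; rewrite !mxE.
  by rewrite [RHS](coord_vbasis (memvf y)); apply: eq_bigr => i _; rewrite !mxE.
apply/rowP => i; rewrite /inv /cplx_coord mxE /=.
rewrite !coord_sum_free ?(basis_free (vbasisP _)) //.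
by case: (r 0 i).
Qed.

HB.instance Definition _ :=
  Lmodule_hasFinDim.Build R[i] (cplx V) cplx_vector_axiom.

Definition cplx_inj (v : V) : cplx V := (v, 0).

(* The canonical map [V ⊗_R V -> V_C ⊗_C V_C]. *)
Definition cplx_tens (t : tens V V) : tens (cplx V) (cplx V) :=
  \sum_i \sum_j ((t : 'M[R]_(_, _)) i j)%:C%C *:
    pure (cplx_inj e`_i) (cplx_inj e`_j).

(* [f ⊗_R id_C], with values in [(V ⊗_R V) ⊗_R C = V_C ⊗_C V_C]. *)
Definition cplx_cobracket (f : V -> tens V V) (v : cplx V) :
    tens (cplx V) (cplx V) :=
  cplx_tens (f v.1) + 'i%C *: cplx_tens (f v.2).

End Vect.

Section Lie.
Variable g : lieAlgType R.
Implicit Types v w : cplx g.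

Definition cplx_lie v w : cplx g :=
  (lie v.1 w.1 - lie v.2 w.2, lie v.1 w.2 + lie v.2 w.1).

Let lieDl (x y z : g) : lie (x + y) z = lie x z + lie y z.
Proof. by have := lie_linearl z 1 x y; rewrite !scale1r. Qed.

Let lieZl a (x z : g) : lie (a *: x) z = a *: lie x z.
Proof.
have lie0 : lie 0 z = 0 by have := lieDl 0 0 z; rewrite addr0 => /eqP; rewrite -subr_eq subrr => /eqP.
by have := lie_linearl z a x 0; rewrite lie0 !addr0.
Qed.

Let lieNl (x z : g) : lie (- x) z = - lie x z.
Proof. by rewrite -scaleN1r lieZl scaleN1r. Qed.

Let linE := (linear0, linearD, linearN, linearZ, lieNl, lieDl).

Let lieC (x y : g) : lie x y = - lie y x.
Proof.
apply/eqP; rewrite -addr_eq0; have := liexx (x + y).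
by rewrite lieDl !linearD /= !liexx add0r addr0 => ->.
Qed.

Fact cplx_lie_linearr v : linear (cplx_lie v).
Proof.
case: v => x y [a b] [z z'] [w w']; congr pair; rewrite /= !linE;
  apply: eq_coord => i; rewrite !linE; ring.
Qed.

Fact cplx_lie_linearl w : linear (cplx_lie^~ w).
Proof.
case: w => x y [a b] [z z'] [w w']; congr pair; rewrite /= !(lieNl, lieDl, lieZl);
  apply: eq_coord => i; rewrite !linE; ring.
Qed.

Fact cplx_liexx v : cplx_lie v v = 0.
Proof.
case: v => x y; rewrite /cplx_lie /= !liexx subr0 [lie y x]lieC.
by rewrite addrN.
Qed.

Fact cplx_lie_jacobi u v w :
  cplx_lie u (cplx_lie v w) + cplx_lie v (cplx_lie w u)
    + cplx_lie w (cplx_lie u v) = 0.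
Proof.
pose jac (a b c : g) :=
  lie a (lie b c) + lie b (lie c a) + lie c (lie a b).
have jac0 a b c : jac a b c = 0 by apply: lie_jacobi.
case: u v w => [x x'] [y y'] [z z']; congr pair; rewrite /= !linE.
  transitivity (jac x y z - jac x y' z' - jac x' y z' - jac x' y' z).
    by apply: eq_coord => i; rewrite /jac !linE; ring.
  by rewrite !jac0 !subr0.
transitivity (jac x' y z + jac x y' z + jac x y z' - jac x' y' z').
  by apply: eq_coord => i; rewrite /jac !linE; ring.
by rewrite !jac0 !addr0 subr0.
Qed.

HB.instance Definition _ := Vector_isLieAlgebra.Build R[i] (cplx g)
  cplx_lie_linearl cplx_lie_linearr cplx_liexx cplx_lie_jacobi.

End Lie.

Definition almost_factorizable (g : lieAlgType R) (delta : g -> tens g g) :=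
  ~ factorizable delta /\ factorizable (cplx_cobracket delta).

End Complexification.

Section BelavinDrinfeld.
Variables (K : numClosedFieldType) (g : lieAlgType K).

Definition diagonalizable_endo (f : 'End(g)) :=
  exists2 X : seq g, basis_of {:g} X
    & forall x, x \in X -> exists a, f x = a *: x.

(* A maximal abelian subalgebra consisting of ad-semisimple elements; over an
   algebraically closed field, semisimple means diagonalizable. *)
Record cartan_subalgebra (h : {vspace g}) : Prop := {
  cartan_abelian : {in h &, forall x y, lie x y = 0};
  cartan_maximal : forall k : {vspace g}, (h <= k)%VS ->
    {in k &, forall x y, lie x y = 0} -> k = h;
  cartan_semisimple : {in h, forall x, diagonalizable_endo (ad x)}
}.

Section Roots.
Variable h : {vspace g}.

Definition csa_dual : vectType K := 'Hom(subvs_of h, K^o).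

(* [alpha(H)]; only meaningful for [H \in h]. *)
Definition csa_eval (alpha : csa_dual) (H : g) : K :=
  (alpha : 'Hom(_, _)) (vsproj h H).

Definition root_space (alpha : csa_dual) : {vspace g} :=
  (\bigcap_(i < \dim h)
     lker (ad (vbasis h)`_i - csa_eval alpha (vbasis h)`_i *: \1%VF)%R)%VS.

Lemma root_spaceP alpha x :
  reflect {in h, forall H, lie H x = csa_eval alpha H *: x}
          (x \in root_space alpha).
Proof.
have memE (i : 'I_(\dim h)) :
    (x \in lker (ad (vbasis h)`_i - csa_eval alpha (vbasis h)`_i *: \1%VF)) =
    (lie (vbasis h)`_i x == csa_eval alpha (vbasis h)`_i *: x).
  by rewrite memv_ker !lfun_simp /= subr_eq0.
apply: (iffP idP) => [/subv_bigcapP xP H hH|xP]; last first.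
  apply/subv_bigcapP => i _; rewrite -memvE memE xP //.
  by rewrite vbasis_mem // mem_nth // size_tuple.
have {}xP (i : 'I_(\dim h)) :
    lie (vbasis h)`_i x = csa_eval alpha (vbasis h)`_i *: x.
  by have := xP i isT; rewrite -memvE memE => /eqP.
have lie_x : linear (lie^~ x) by apply: lie_linearl.
pose lx : {linear g -> g} :=
  HB.pack (lie^~ x) (GRing.isLinear.Build K g g _ _ lie_x).
rewrite -[LHS]/(lx H) /csa_eval [in LHS](coord_vbasis hH).
rewrite [in RHS](coord_vbasis hH) !linear_sum scaler_suml.
by apply: eq_bigr => i _; rewrite !linearZ /= [lie _ _]xP scalerA.
Qed.

Definition is_root (alpha : csa_dual) : bool :=
  (alpha != 0) && (root_space alpha != 0%VS).

(* The submonoid generated by [S], for [S] without repetition. *)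
Definition nat_span (S : seq csa_dual) (alpha : csa_dual) : Prop :=
  exists k : csa_dual -> nat, alpha = \sum_(s <- S) s *+ k s.

(* The subgroup generated by [S], for [S] without repetition. *)
Definition int_span (S : seq csa_dual) (alpha : csa_dual) : Prop :=
  exists k : csa_dual -> int, alpha = \sum_(s <- S) s *~ k s.

End Roots.

(* A bilinear form is encoded by the induced map from [g] to its dual. *)
Record invariant_form (B : 'Hom(g, 'Hom(g, K^o))) : Prop := {
  form_sym : forall x y, B x y = B y x;
  form_invariant : forall x y z, B (lie x y) z = B x (lie y z);
  form_nondegenerate : lker B = 0%VS
}.

(* [∑ e_i ⊗ e^i], where [(e^i)] is the basis dual to [(e_i)] for [B]. *)
Definition casimir (B : 'Hom(g, 'Hom(g, K^o))) : tens g g :=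
  \sum_(i < \dim {:g})
    pure (vbasis {:g})`_i
      ((B^-1)%VF (linfun (coord (vbasis {:g}) i : g -> K^o))).

Definition csa_form (B : 'Hom(g, 'Hom(g, K^o))) (h : {vspace g}) :
    'Hom(subvs_of h, csa_dual h) :=
  linfun (fun H => linfun (fun H' => B (vsval H) (vsval H') : K^o)).

Lemma csa_formE B h (H H' : subvs_of h) :
  (csa_form B h H : 'Hom(_, _)) H' = B (vsval H) (vsval H').
Proof.
pose row (a : subvs_of h) : subvs_of h -> K^o := fun b => B (vsval a) (vsval b).
have row_lin a : linear (row a) by move=> c x y; rewrite /row !linearP.
have rowE a b : linfun (row a) b = row a b.
  pose f : {linear subvs_of h -> K^o} :=
    HB.pack (row a) (GRing.isLinear.Build K _ _ _ _ (row_lin a)).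
  exact: (lfunE f).
have lin : linear (fun a => linfun (row a) : csa_dual h).
  move=> c x y; apply/lfunP => b.
  by rewrite !lfun_simp !rowE /row !linearP !lfun_simp.
pose f : {linear subvs_of h -> csa_dual h} :=
  HB.pack (fun a => linfun (row a) : csa_dual h)
    (GRing.isLinear.Build K _ _ _ _ lin).
by rewrite /csa_form (lfunE f) /= rowE.
Qed.

Record root_datum := RootDatum {
  rd_form : 'Hom(g, 'Hom(g, K^o));
  rd_formP : invariant_form rd_form;
  rd_csa : {vspace g};
  rd_csaP : cartan_subalgebra rd_csa;
  rd_roots : seq (csa_dual rd_csa);
  rd_roots_uniq : uniq rd_roots;
  rd_rootsP : rd_roots =i @is_root rd_csa;
  rd_simple : seq (csa_dual rd_csa);
  rd_simple_roots : {subset rd_simple <= rd_roots};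
  rd_simple_basis : basis_of fullv rd_simple;
  rd_simple_span : {in rd_roots, forall alpha,
    nat_span rd_simple alpha \/ nat_span rd_simple (- alpha)}
}.

Section Datum.
Variable rd : root_datum.
Local Notation B := (rd_form rd).
Local Notation h := (rd_csa rd).
Local Notation hdual := (csa_dual h).
Implicit Types (alpha beta : hdual) (S : seq hdual).

Definition positive_roots : seq hdual :=
  [seq alpha <- rd_roots rd | `[< nat_span (rd_simple rd) alpha >]].

(* The form on [h^*] induced by [B], via the isomorphism [h -> h^*]. *)
Definition csa_dual_form alpha beta : K :=
  B (vsval ((csa_form B h)^-1%VF alpha)) (vsval ((csa_form B h)^-1%VF beta)).

(* The projection onto [h] along the sum of the root spaces. *)
Definition csa_proj : 'End(g) :=
  daddv_pi h (\sum_(alpha <- rd_roots rd) root_space alpha)%VS.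

(* The [h ⊗ h]-component of the Casimir element. *)
Definition casimir0 : tens g g := tmap csa_proj csa_proj (casimir B).

Definition root_vectors (x : hdual -> g) :=
  {in rd_roots rd, forall alpha, x alpha \in root_space alpha} /\
  {in positive_roots, forall alpha, B (x alpha) (x (- alpha)) = 1}.

(* Only the values of [bd_tau] on [bd_dom] are relevant. *)
Record bd_triple := BDTriple {
  bd_dom : seq hdual;
  bd_cod : seq hdual;
  bd_tau : hdual -> hdual;
  bd_dom_uniq : uniq bd_dom;
  bd_cod_uniq : uniq bd_cod;
  bd_dom_simple : {subset bd_dom <= rd_simple rd};
  bd_cod_simple : {subset bd_cod <= rd_simple rd};
  bd_tau_inj : {in bd_dom &, injective bd_tau};
  bd_tau_im : map bd_tau bd_dom =i bd_cod;
  bd_tau_isometry : {in bd_dom &, forall alpha beta,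
    csa_dual_form (bd_tau alpha) (bd_tau beta) = csa_dual_form alpha beta};
  bd_tau_nilpotent : {in bd_dom, forall alpha, exists n : nat,
    [/\ (0 < n)%N,
        forall m, (m < n)%N -> iter m bd_tau alpha \in bd_dom,
        iter n bd_tau alpha \in bd_cod
      & iter n bd_tau alpha \notin bd_dom]}
}.

Section Triple.
Variable T : bd_triple.

(* The graph of the additive extension of [tau] to the subgroup generated by
   [Gamma_1], and those of its iterates as partial maps. *)
Definition tau_ext alpha beta :=
  exists k : hdual -> int,
    alpha = \sum_(s <- bd_dom T) s *~ k s /\
    beta = \sum_(s <- bd_dom T) bd_tau T s *~ k s.

Fixpoint tau_iter n alpha beta : Prop :=
  if n is n'.+1 then exists2 gamma, tau_ext alpha gamma & tau_iter n' gamma beta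
  else alpha = beta.

Definition bd_prec alpha beta :=
  [/\ alpha \in positive_roots /\ int_span (bd_dom T) alpha,
      beta \in positive_roots /\ int_span (bd_cod T) beta
    & exists2 n, (0 < n)%N & tau_iter n alpha beta].

Definition continuous_parameter (r0 : tens (subvs_of h) (subvs_of h)) :=
  {in bd_dom T, forall alpha,
    tlift (fun H H' => (bd_tau T alpha : 'Hom(_, _)) H *: H'
                       + (alpha : 'Hom(_, _)) H' *: H) r0 = 0} /\
  tmap vsval vsval r0 + tswap (tmap vsval vsval r0) = casimir0.

Definition bd_rmatrix (r0 : tens (subvs_of h) (subvs_of h))
    (x : hdual -> g) : tens g g :=
  tmap vsval vsval r0
  + \sum_(alpha <- positive_roots) pure (x (- alpha)) (x alpha)
  + \sum_(alpha <- positive_roots)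
      \sum_(beta <- positive_roots | `[< bd_prec alpha beta >])
        (pure (x (- alpha)) (x beta) - pure (x beta) (x (- alpha))).

End Triple.
End Datum.
End BelavinDrinfeld.

(* Main.v *)
Require Import Defs.
From HB Require Import structures.
From mathcomp Require Import all_boot all_order all_algebra.
From mathcomp Require Import complex ring.
From mathcomp Require Import boolp reals.

Set Implicit Arguments.
Unset Strict Implicit.
Unset Printing Implicit Defensive.

Import Order.TTheory GRing.Theory Num.Theory.
Local Open Scope ring_scope.

(** Let [D] be a biderivation and [r] the r-matrix.  As a derivation, [D] is
    inner, [D = ad X] ([derivation_inner]).  Compatibility with the cobracket
    [x |-> ad_x r] then says that the tensor [ad_X r] is invariant.  It is also
    skew, being the value of the cobracket at [X], and there is no nonzero
    invariant skew tensor ([invariant_skew_eq0]).  Hence [ad_X r = 0].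

    Everything is read through the invariant form: [ad_X r = 0] means that
    [r([X, u], v) + r(u, [X, v]) = 0] for all [u] and [v].  For a positive root
    [gamma], take [u] in [h] and [v = x_(-gamma)] or [v = x_gamma].  The terms
    of [r] indexed by pairs [alpha < beta] contribute coordinates of [X] at
    roots below [gamma], respectively at opposites of roots above [gamma], for
    the Belavin-Drinfeld order.  This order is acyclic ([bd_prec_rank]), so by
    induction these coordinates vanish.  If the coordinate of [X] at [gamma],
    respectively [- gamma], did not vanish, what remains would give
    [r0(h_gamma, h_gamma) = (gamma, gamma)], respectively [0], whereas
    [r0 + r0^21 = Omega_0] makes it half of [(gamma, gamma)], which is nonzero
    ([root_norm_neq0]).  Therefore [X] lies in [h] ([fixes_rmatrix_csa]), and
    the choice [u = x_alpha], [v = x_(-tau alpha)] gives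
    [alpha(X) = (tau alpha)(X)] ([fixes_rmatrix_tau]).  Conversely, for an
    empty triple all summands of [r] have weight zero, so [ad_H r = 0] for [H]
    in [h] ([csa_fixes_rmatrix]).

    Derivations are inner because the Killing form is nondegenerate.  That is
    obtained from the root decomposition: strings of root vectors show that the
    weights take rational values on the coroots ([weight_ratio]), so on [h] the
    Killing form is, up to complex conjugation of coordinates, a sum of squared
    absolute values ([weight_sum_nondegenerate]).  The same strings show that
    root spaces are lines ([root_space_line]).

    Over the reals, a biderivation extends to the complexification, where it is
    [ad X]; since it preserves the real form, [X] is real. *)

(** * Linear maps, bilinear forms and traces *)

Section LinearPredicate.
Variables (K : fieldType) (U V : lmodType K) (f : U -> V).
Hypothesis lin_f : linear f.

Let F : {linear U -> V} := HB.pack f (GRing.isLinear.Build K U V _ f lin_f).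

Lemma lin0 : f 0 = 0. Proof. exact: (linear0 F). Qed.
Lemma linD : {morph f : u v / u + v}. Proof. exact: (linearD F). Qed.
Lemma linN : {morph f : u / - u}. Proof. exact: (linearN F). Qed.
Lemma linB : {morph f : u v / u - v}. Proof. exact: (linearB F). Qed.
Lemma linZ a : {morph f : u / a *: u}. Proof. exact: (linearZ_LR F a). Qed.
Lemma lin_sum I (r : seq I) P (E : I -> U) :
  f (\sum_(i <- r | P i) E i) = \sum_(i <- r | P i) f (E i).
Proof. exact: (linear_sum F). Qed.

End LinearPredicate.

Lemma linfunE (K : fieldType) (U V : vectType K) (f : U -> V) :
  linear f -> linfun f =1 f.
Proof.
move=> lin_f; pose F : {linear U -> V} :=
  HB.pack f (GRing.isLinear.Build K U V _ f lin_f).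
exact: (lfunE F).
Qed.

Section Bilinear.
Variables (K : fieldType) (V : vectType K).
Implicit Types F : V -> V -> K.

Definition bilinear_form F :=
  (forall v, linear (F^~ v : V -> K^o)) /\ (forall u, linear (F u : V -> K^o)).

(** Injectivity of [V -> V^*] forces surjectivity because the two spaces have
    the same dimension. *)
Lemma nondegenerate_represents F (phi : V -> K^o) :
    bilinear_form F -> (forall u, (forall v, F u v = 0) -> u = 0) ->
    linear phi ->
  exists u, forall v, F u v = phi v.
Proof.
move=> [linl linr] ndF lin_phi.
pose flat u : 'Hom(V, K^o) := linfun (F u : V -> K^o).
have flatE u v : flat u v = F u v by rewrite /flat linfunE.
have lin_flat : linear flat.
  by move=> a u v; apply/lfunP => w; rewrite !lfun_simp !flatE linl.
pose B := linfun flat.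
have BE u v : B u v = F u v by rewrite /B (linfunE lin_flat) flatE.
have kerB : lker B = 0%VS.
  apply/eqP; rewrite -subv0; apply/subvP => u; rewrite memv_ker => /eqP Bu0.
  by rewrite memv0; apply/eqP/ndF => v; rewrite -BE Bu0 lfunE.
have imB : limg B = fullv.
  apply/eqP; rewrite eqEdim subvf limg_dim_eq ?kerB ?capv0 // !dimvf.
  by rewrite /dim /= muln1.
exists ((B^-1)%VF (linfun phi)) => v.
by rewrite -BE limg_lfunVK ?imB ?memvf // linfunE.
Qed.

End Bilinear.

Section EigenBasis.
Variables (K : fieldType) (V : vectType K).
Local Notation b := (vbasis {:V}).
Local Notation bP := (vbasisP {:V}).
Import passmx.

(** Transport to endomorphisms of the simultaneous diagonalization of commuting
    matrices, through the coordinates in [vbasis fullv]. *)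
Lemma common_eigenbasis (fs : seq 'End(V)) :
    {in fs &, forall f g : 'End(V), (f \o g = g \o f)%VF} ->
    {in fs, forall f : 'End(V), exists2 X : seq V, basis_of {:V} X
       & forall x, x \in X -> exists a, f x = a *: x} ->
  exists2 e : (\dim {:V}).-tuple V, basis_of {:V} e
    & {in fs, forall (f : 'End(V)) i, exists a, f e`_i = a *: e`_i}.
Proof.
move=> commf diagf.
have vecof_inj u : vecof b u = 0 -> u = 0.
  by move/eqP; rewrite (vecof_eq0 bP) => /eqP.
have diag_mx f : f \in fs -> diagonalizable (mxof b b f).
  move=> /diagf[X basX eigX].
  have szX : size X = \dim {:V}.
    by rewrite -(size_basis (X := in_tuple X) basX).
  have eig (i : 'I_(\dim {:V})) : exists a, f X`_i = a *: X`_i.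
    by apply/eigX/mem_nth; rewrite szX.
  have {eig} [d dP] := choice eig.
  pose P := \matrix_(i < \dim {:V}) rVof b X`_i.
  have vecP u : vecof b (u *m P) = \sum_i u 0 i *: X`_i.
    rewrite mulmx_sum_row linear_sum; apply: eq_bigr => i _.
    by rewrite linearZ /= rowK; congr (_ *: _); exact: (rVofK bP).
  have unitP : P \in unitmx.
    rewrite -row_free_unit; apply: inj_row_free => u uP0; apply/rowP => i.
    have X_t : size X == \dim {:V} by apply/eqP.
    have /(@freeP _ _ _ (Tuple X_t)) fX := basis_free basX.
    rewrite [RHS]mxE; apply: fX.
    by rewrite -vecP uP0 linear0.
  exists P => //; apply/diagonalizable_forPex; exists (\row_i d i).
  apply/(simmxP unitP)/row_matrixP => i; rewrite !row_mul rowK row_diag_mx mxE.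
  rewrite -scalemxAl -rowE rowK; apply: (can_inj (vecofK bP)).
  by rewrite linearZ /= mul_mxof !(rVofK bP) dP.
have [_ /(_ _)] := codiagonalizableP [seq mxof b b f | f <- fs].
have [cP _] := codiagonalizableP [seq mxof b b f | f <- fs].
case: cP => [|P unitP /allP diagP _].
  split=> [_ _ /mapP[f fsf ->] /mapP[f' fsf' ->]|_ /mapP[f fsf ->]].
    by rewrite /comm_mx -!(mxof_comp _ _ bP) commf.
  exact: diag_mx.
pose e := [tuple vecof b (row i P) | i < \dim {:V}].
have eE (i : 'I_(\dim {:V})) : e`_i = vecof b (row i P).
  by rewrite -tnth_nth tnth_mktuple.
have freee : free e.
  apply/freeP => k k0 i.
  suff: (\row_i k i) *m P = 0.
    move/(congr1 (mulmx^~ (invmx P))); rewrite mulmxK // mul0mx.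
    by move/rowP/(_ i); rewrite !mxE.
  apply: vecof_inj; rewrite mulmx_sum_row linear_sum -[RHS]k0.
  by apply: eq_bigr => j _; rewrite linearZ /= mxE eE.
exists e.
  by rewrite basisEfree freee subvf size_tuple leqnn.
move=> f fsf i; have [lt_i|ge_i] := ltnP i (\dim {:V}); last first.
  by exists 0; rewrite nth_default ?size_tuple // linear0 scaler0.
have := diagP _ (map_f _ fsf) => /= /diagonalizable_forPex[d /(simmxP unitP)].
move/(congr1 (row (Ordinal lt_i))); rewrite !row_mul row_diag_mx -scalemxAl.
rewrite -rowE => PA; exists (d 0 (Ordinal lt_i)).
by rewrite (eE (Ordinal lt_i)) -[LHS](rVofK bP) -mul_mxof PA linearZ.
Qed.

End EigenBasis.

Section Trace.
Variables (K : fieldType) (V : vectType K) (e : (\dim {:V}).-tuple V).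
Hypothesis basis_e : basis_of {:V} e.
Implicit Types f g : 'End(V).

Definition endo_trace f : K := \sum_i coord e i (f e`_i).

Lemma endo_trace_linear : linear (endo_trace : 'End(V) -> K^o).
Proof.
move=> a f g; rewrite /endo_trace.
transitivity (\sum_i (a * coord e i (f e`_i) + coord e i (g e`_i))).
  by apply: eq_bigr => i _; rewrite !lfun_simp linearP.
by rewrite big_split /= -mulr_sumr.
Qed.

Lemma endo_traceC f g : endo_trace (f \o g)%VF = endo_trace (g \o f)%VF.
Proof.
have E f' g' : endo_trace (f' \o g')%VF =
    \sum_(i < \dim {:V}) \sum_j coord e j (g' e`_i) * coord e i (f' e`_j).
  apply: eq_bigr => i _; rewrite comp_lfunE.
  rewrite {1}[g' _](coord_basis basis_e) ?memvf // !linear_sum.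
  by apply: eq_bigr => j _; rewrite !linearZ.
rewrite !E exchange_big /=.
by apply: eq_bigr => i _; apply: eq_bigr => j _; rewrite mulrC.
Qed.

Lemma endo_trace_diag f (a : 'I_(\dim {:V}) -> K) :
  (forall i : 'I_(\dim {:V}), f e`_i = a i *: e`_i) ->
  endo_trace f = \sum_i a i.
Proof.
move=> fe; apply: eq_bigr => i _.
by rewrite fe linearZ /= coord_free ?(basis_free basis_e) // eqxx mulr1.
Qed.

End Trace.

(** * Tensors and Lie brackets *)

Section TensorMaps.
Variable K : fieldType.
Implicit Types U V W : vectType K.

Lemma pure_linearl V W (w : W) : linear (fun v : V => pure v w).
Proof.
move=> a v v'; apply/matrixP => i j.
by rewrite !mxE linearP mulrDl -mulrA.
Qed.

Lemma pure_linearr V W (v : V) : linear (fun w : W => pure v w).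
Proof.
move=> a w w'; apply/matrixP => i j.
by rewrite !mxE linearP mulrDr mulrCA.
Qed.

Lemma tlift_linear V W U (b : V -> W -> U) : linear (tlift b).
Proof.
move=> a s t; rewrite /tlift scaler_sumr -big_split; apply: eq_bigr => i _ /=.
rewrite scaler_sumr -big_split; apply: eq_bigr => j _ /=.
by rewrite !mxE scalerDl scalerA.
Qed.

Lemma tens_ext V W U (f f' : tens V W -> U) : linear f -> linear f' ->
  (forall v w, f (pure v w) = f' (pure v w)) -> f =1 f'.
Proof.
move=> lin_f lin_f' eq_ff' t; rewrite (tensE t) /tlift.
rewrite (lin_sum lin_f) (lin_sum lin_f'); apply: eq_bigr => i _.
rewrite (lin_sum lin_f) (lin_sum lin_f'); apply: eq_bigr => j _.
by rewrite (linZ lin_f) (linZ lin_f') eq_ff'.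
Qed.

Lemma linear_comp U V W (f : V -> W) (f' : U -> V) :
  linear f -> linear f' -> linear (fun x => f (f' x)).
Proof. by move=> lin_f lin_f' a u v; rewrite lin_f' lin_f. Qed.

Lemma linear_add U V (f f' : U -> V) :
  linear f -> linear f' -> linear (fun x => f x + f' x).
Proof.
by move=> lin_f lin_f' a u v; rewrite lin_f' lin_f scalerDr addrACA.
Qed.

Lemma tmap_pure V W V' W' (f : V -> V') (f' : W -> W') v w :
  linear f -> linear f' -> tmap f f' (pure v w) = pure (f v) (f' w).
Proof.
move=> lin_f lin_f'; rewrite /tmap tliftE // => u.
  exact: linear_comp (pure_linearl _) lin_f.
exact: linear_comp (pure_linearr _) lin_f'.
Qed.

Lemma tswap_pure V W (v : V) (w : W) : tswap (pure v w) = pure w v.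
Proof.
by rewrite /tswap tliftE // => u; [apply: pure_linearr|apply: pure_linearl].
Qed.

Lemma tder_pure V (D : V -> V) v w : linear D ->
  tder D (pure v w) = pure (D v) w + pure v (D w).
Proof.
move=> lin_D; rewrite /tder tliftE // => u; apply: linear_add.
- exact: linear_comp (pure_linearl _) lin_D.
- exact: pure_linearl.
- exact: pure_linearr.
- exact: linear_comp (pure_linearr _) lin_D.
Qed.

End TensorMaps.

Section LieBasics.
Variables (K : fieldType) (g : lieAlgType K).
Implicit Types (x y z : g) (D : 'End(g)) (t : tens g g)
  (phi psi : 'Hom(g, K^o)).

Lemma lieDl x y z : lie (x + y) z = lie x z + lie y z.
Proof. exact: linD (lie_linearl z) _ _. Qed.
Lemma lieZl a x z : lie (a *: x) z = a *: lie x z.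
Proof. exact: linZ (lie_linearl z) _ _. Qed.
Lemma lieNl x z : lie (- x) z = - lie x z.
Proof. exact: linN (lie_linearl z) _. Qed.
Lemma lie0l z : lie 0 z = 0.
Proof. exact: lin0 (lie_linearl z). Qed.
Lemma lieC x y : lie x y = - lie y x.
Proof.
apply/eqP; rewrite -addr_eq0; have := liexx (x + y).
by rewrite lieDl !linearD /= !liexx add0r addr0 => ->.
Qed.

Lemma lie_lie x y z : lie x (lie y z) = lie (lie x y) z + lie y (lie x z).
Proof.
have := lie_jacobi x y z; rewrite [lie z (lie x y)]lieC [lie z x]lieC linearN.
by move/eqP; rewrite -addrA -opprD addr_eq0 opprK addrC => /eqP.
Qed.

Lemma adE x y : ad x y = lie x y. Proof. by rewrite lfunE. Qed.

Lemma ad_lie x y : ad (lie x y) = ((ad x \o ad y) - (ad y \o ad x))%VF.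
Proof.
by apply/lfunP => z; rewrite !lfun_simp /= [in RHS]lie_lie addrK.
Qed.

Lemma derivation_ad x : derivation (ad x).
Proof. by move=> y z; rewrite !adE lie_lie. Qed.

Lemma tform_linear phi psi :
  linear ((fun t => tform t phi psi) : tens g g -> K^o).
Proof. exact: tlift_linear. Qed.

Lemma tform_pure x y phi psi : tform (pure x y) phi psi = phi x * psi y.
Proof.
rewrite /tform tliftE // => u a v w; rewrite linearP.
  by rewrite mulrDl -scalerAl.
by rewrite mulrDr -scalerAr.
Qed.

Lemma tform_swap t phi psi : tform (tswap t) phi psi = tform t psi phi.
Proof.
apply: (@tens_ext _ _ _ K^o (fun s => tform (tswap s) phi psi)
  (fun s => tform s psi phi)) => [||x y].
- exact: linear_comp (tform_linear _ _) (tlift_linear _).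
- exact: tform_linear.
by rewrite tswap_pure !tform_pure mulrC.
Qed.

Lemma tform_tder D t phi psi :
  tform (tder D t) phi psi
  = tform t (phi \o D)%VF psi + tform t phi (psi \o D)%VF.
Proof.
refine (@tens_ext _ _ _ K^o (fun s => tform (tder D s) phi psi)
  (fun s => tform s (phi \o D)%VF psi + tform s phi (psi \o D)%VF)
  _ _ _ t) => [||x y].
- exact: linear_comp (tform_linear _ _) (tlift_linear _).
- exact: linear_add (tform_linear _ _) (tform_linear _ _).
rewrite tder_pure; last exact: linearP.
by rewrite (linD (tform_linear _ _)) !tform_pure !lfun_simp.
Qed.

Lemma tad_ad x t : tad x t = tder (ad x) t.
Proof. by rewrite /tad; congr (tder _ t); apply/funext => y; rewrite adE. Qed.

Lemma tform_linearl t psi : linear (fun phi => tform t phi psi : K^o).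
Proof.
move=> a phi phi'; rewrite /tform /tlift scaler_sumr -big_split.
apply: eq_bigr => i _; rewrite scaler_sumr -big_split; apply: eq_bigr => j _ /=.
by rewrite !lfun_simp mulrDl scalerDr -scalerAl !scalerA [a * _]mulrC.
Qed.

Lemma tform_linearr t phi : linear (fun psi => tform t phi psi : K^o).
Proof.
by move=> a psi psi'; rewrite -!(tform_swap t); apply: tform_linearl.
Qed.

Lemma tad_lie x y t : tad x (tad y t) = tad (lie x y) t + tad y (tad x t).
Proof.
have lin_tder (D : g -> g) : linear (tder D) by apply: tlift_linear.
apply: (@tens_ext _ _ _ _ (fun s => tad x (tad y s))
  (fun s => tad (lie x y) s + tad y (tad x s))) => [||v w].
- exact: linear_comp (lin_tder _) (lin_tder _).
- exact: linear_add (lin_tder _) (linear_comp (lin_tder _) (lin_tder _)).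
rewrite /tad !tder_pure ?(linD (lin_tder _)) ?tder_pure;
  try exact: lie_linearr.
rewrite !(lie_lie x y) (linD (pure_linearl _)) (linD (pure_linearr _)).
by apply/matrixP => i j; rewrite !mxE; ring.
Qed.

End LieBasics.

(** * Weights of a Cartan subalgebra *)

Definition invariant_bilinear (K : fieldType) (g : lieAlgType K)
    (F : g -> g -> K) :=
  bilinear_form F /\ forall y u v, F (lie y u) v + F u (lie y v) = 0.

Section Weights.
Variables (K : numClosedFieldType) (g : lieAlgType K) (rd : root_datum g).
Local Notation B := (rd_form rd).
Local Notation h := (rd_csa rd).
Local Notation hdual := (csa_dual h).
Local Notation root_space := (@root_space K g h).
Local Notation ev := (@csa_eval K g h).
Implicit Types (alpha beta gamma : hdual) (x y z u v H : g).

Lemma csa_evalD alpha beta H : ev (alpha + beta) H = ev alpha H + ev beta H.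
Proof. by rewrite /csa_eval lfun_simp. Qed.
Lemma csa_evalN alpha H : ev (- alpha) H = - ev alpha H.
Proof. by rewrite /csa_eval lfun_simp. Qed.
Lemma csa_eval0 H : ev (0 : hdual) H = 0.
Proof. by rewrite /csa_eval lfun_simp. Qed.
Lemma csa_evalZ a alpha H : ev (a *: alpha) H = a * ev alpha H.
Proof. by rewrite /csa_eval lfun_simp. Qed.
Lemma csa_evalMn alpha n H : ev (alpha *+ n) H = ev alpha H *+ n.
Proof.
by elim: n => [|n IHn]; rewrite ?csa_eval0 // !mulrS csa_evalD IHn.
Qed.
Lemma csa_eval_linear alpha : linear (csa_eval alpha : g -> K^o).
Proof. by move=> a H H'; rewrite /csa_eval !linearP. Qed.
Lemma csa_eval_sum I (r : seq I) (a : I -> K) (E : I -> hdual) H :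
  ev (\sum_(i <- r) a i *: E i) H = \sum_(i <- r) a i * ev (E i) H.
Proof.
elim: r => [|i r IHr]; rewrite ?big_nil ?csa_eval0 // !big_cons.
by rewrite csa_evalD csa_evalZ IHr.
Qed.

Lemma csa_dual_ext alpha beta : {in h, forall H, ev alpha H = ev beta H} ->
  alpha = beta.
Proof.
move=> eqab; apply/lfunP => H; have := eqab _ (subvsP H).
by rewrite /csa_eval vsvalK.
Qed.

Lemma csa_dual_neq0 alpha : alpha != 0 -> exists2 H, H \in h & ev alpha H != 0.
Proof.
move=> alpha0; apply: contrapT => noH; case/eqP: alpha0.
apply: csa_dual_ext => H hH; rewrite csa_eval0; apply/eqP.
by apply: contraT => aH0; case: noH; exists H.
Qed.

Lemma lie_weight alpha H x :
  x \in root_space alpha -> H \in h -> lie H x = ev alpha H *: x.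
Proof. by move=> /root_spaceP; apply. Qed.

Lemma weight_lie alpha beta x y :
  x \in root_space alpha -> y \in root_space beta ->
  lie x y \in root_space (alpha + beta).
Proof.
move=> /root_spaceP xa /root_spaceP yb; apply/root_spaceP => H hH.
rewrite lie_lie (xa H hH) (yb H hH) lieZl linearZ /=.
by rewrite csa_evalD scalerDl.
Qed.

(** Maximality of the abelian subalgebra [h] makes it its own centralizer. *)
Lemma weight0 : root_space 0 = h.
Proof.
have [abel max _] := rd_csaP rd.
apply/vspaceP => x; apply/root_spaceP/idP => [x0|hx H hH]; last first.
  by rewrite csa_eval0 scale0r abel.
have {}x0 H : H \in h -> lie H x = 0.
  by move=> /x0 ->; rewrite csa_eval0 scale0r.
rewrite -(max (h + <[x]>)%VS) ?addvSl ?memvE ?addvSr //.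
move=> _ _ /memv_addP[H hH [_ /vlineP[a ->] ->]]
  /memv_addP[H' hH' [_ /vlineP[a' ->] ->]].
rewrite lieDl !linearD /= !lieZl !linearZ /= abel // x0 //.
by rewrite [lie x H']lieC x0 // liexx oppr0 !scaler0 !addr0.
Qed.

Lemma csa_weight0 H : H \in h -> H \in root_space 0.
Proof. by rewrite weight0. Qed.

Lemma weight_basis : exists2 e : (\dim {:g}).-tuple g, basis_of {:g} e
  & exists w : nat -> hdual, forall i, e`_i \in root_space (w i).
Proof.
have [abel _ diag] := rd_csaP rd.
have [|f /mapP[H /vbasis_mem hH ->]|e basis_e eig] :=
    @common_eigenbasis _ g [seq ad H | H <- vbasis h].
- move=> _ _ /mapP[H /vbasis_mem hH ->] /mapP[H' /vbasis_mem hH' ->].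
  apply/eqP; rewrite -subr_eq0 -ad_lie abel //; apply/eqP/lfunP => x.
  by rewrite adE lie0l lfunE.
- exact: diag.
exists e => //.
have {eig} eig i H : H \in h -> exists a, lie H e`_i = a *: e`_i.
  move=> hH; have eigj (j : 'I_(\dim h)) : exists a,
      lie (vbasis h)`_j e`_i = a *: e`_i.
    have [|a aP] := eig (ad (vbasis h)`_j) _ i; last by exists a; rewrite -adE.
    by rewrite map_f // mem_nth // size_tuple.
  have [a aP] := choice eigj.
  exists (\sum_j coord (vbasis h) j H * a j).
  rewrite {1}(coord_vbasis hH) (lin_sum (lie_linearl _)) scaler_suml.
  by apply: eq_bigr => j _; rewrite lieZl aP scalerA.
suff /choice[w wP] : forall i, exists w : hdual, e`_i \in root_space w.
  by exists w.
move=> i; have [lt_i|ge_i] := ltnP i (\dim {:g}); last first.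
  by exists 0; rewrite nth_default ?size_tuple // mem0v.
pose i' := Ordinal lt_i.
pose w (H : subvs_of h) : K^o := coord e i' (lie (vsval H) e`_i).
have lin_w : linear w.
  by move=> a H H'; rewrite /w !linearP lieDl lieZl linearP.
exists (linfun w); apply/root_spaceP => H hH.
have [a aP] := eig i _ hH.
rewrite aP /csa_eval linfunE // /w vsprojK // aP linearZ /=.
by rewrite (coord_free i' i') ?(basis_free basis_e) // eqxx mulr1.
Qed.

Lemma weight_ext (U : vectType K) (f f' : g -> U) : linear f -> linear f' ->
  (forall alpha x, x \in root_space alpha -> f x = f' x) -> f =1 f'.
Proof.
move=> lin_f lin_f' eqff' x; have [e basis_e [w eP]] := weight_basis.
rewrite (coord_basis basis_e (memvf x)) (lin_sum lin_f) (lin_sum lin_f').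
by apply: eq_bigr => i _; rewrite (linZ lin_f) (linZ lin_f') (eqff' _ _ (eP i)).
Qed.

Lemma weight_form0 (F : g -> g -> K) alpha beta u v :
  invariant_bilinear F -> u \in root_space alpha -> v \in root_space beta ->
  alpha + beta != 0 -> F u v = 0.
Proof.
move=> [[linl linr] invF] ua vb /csa_dual_neq0[H hH abH0].
have /eqP : (ev alpha H + ev beta H) * F u v = 0.
  rewrite mulrDl -(invF H u v) (lie_weight ua) // (lie_weight vb) //.
  by rewrite (linZ (linl v)) (linZ (linr u)).
by rewrite -csa_evalD mulf_eq0 (negPf abH0) => /eqP.
Qed.

Lemma form_bilinear : bilinear_form (fun u v => B u v).
Proof. by split=> [v a u u'|u a v v']; rewrite ?linearP ?lfun_simp. Qed.

Lemma form_lie x y z : B (lie x y) z = - B y (lie x z).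
Proof. by rewrite lieC linearN lfun_simp (form_invariant (rd_formP rd)). Qed.

Lemma form_invariant_bilinear : invariant_bilinear (fun u v => B u v).
Proof.
by split=> [|y u v]; rewrite ?form_lie ?addNr //; apply: form_bilinear.
Qed.

Lemma form_weight0 alpha beta u v :
  u \in root_space alpha -> v \in root_space beta -> alpha + beta != 0 ->
  B u v = 0.
Proof. exact: weight_form0 form_invariant_bilinear. Qed.

Lemma form_csa0 alpha H v : H \in h -> v \in root_space alpha -> alpha != 0 ->
  B H v = 0.
Proof.
by move=> /csa_weight0 h0 va a0; rewrite (form_weight0 h0 va) // add0r.
Qed.

Lemma form_eq0 x : (forall y, B x y = 0) -> x = 0.
Proof.
move=> Bx0; apply/eqP; rewrite -memv0 -(form_nondegenerate (rd_formP rd)).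
by rewrite memv_ker; apply/eqP/lfunP => y; rewrite Bx0 lfunE.
Qed.

Lemma form_csa_eq0 H : H \in h -> {in h, forall H', B H H' = 0} -> H = 0.
Proof.
move=> hH BH0; apply: form_eq0.
apply: (weight_ext (U := K^o) (f := B H) (f' := fun=> 0)) => [||alpha x xa].
- exact: linearP.
- by move=> a u v; rewrite scaler0 addr0.
have [a0|a0] := eqVneq alpha 0; last exact: form_csa0 xa a0.
by rewrite BH0 // -weight0 -a0.
Qed.

(** The element usually written [h_alpha]. *)
Definition form_dual alpha : g := vsval ((csa_form B h)^-1%VF alpha).

Lemma form_dual_csa alpha : form_dual alpha \in h. Proof. exact: subvsP. Qed.

Lemma form_dualE alpha H : H \in h -> B (form_dual alpha) H = ev alpha H.
Proof.
move=> hH; have lin_a : linear (alpha : subvs_of h -> K^o) by apply: linearP.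
have [||u uP] := nondegenerate_represents
    (F := fun H H' : subvs_of h => B (vsval H) (vsval H')) _ _ lin_a.
- by split=> [v a u u'|u a v v']; rewrite !linearP ?lfun_simp.
- move=> u Bu0; apply/subvs_inj/form_csa_eq0; first exact: subvsP.
  by move=> H' hH'; rewrite -(vsprojK hH') Bu0.
have aE : csa_form B h u = alpha by apply/lfunP => v; rewrite csa_formE uP.
rewrite -[H in LHS](vsprojK hH) -csa_formE limg_lfunVK //.
by rewrite -aE memv_img ?memvf.
Qed.

Lemma form_dual_linear : linear form_dual.
Proof. by move=> a alpha beta; rewrite /form_dual !linearP. Qed.

Lemma form_dual_eq0 alpha : form_dual alpha = 0 -> alpha = 0.
Proof.
move=> a0; apply: csa_dual_ext => H hH.
by rewrite csa_eval0 -form_dualE // a0 linear0 lfunE.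
Qed.

Lemma form_dualK H : H \in h ->
  H = form_dual (csa_form B h (vsproj h H)).
Proof.
move=> hH; apply/eqP; rewrite -subr_eq0; apply/eqP/form_csa_eq0.
  by rewrite memvB // form_dual_csa.
move=> H' hH'; rewrite linearB add_lfunE opp_lfunE form_dualE // /csa_eval.
by rewrite csa_formE !vsprojK // subrr.
Qed.

Lemma lie_opposite alpha x y :
  x \in root_space alpha -> y \in root_space (- alpha) ->
  lie x y = B x y *: form_dual alpha.
Proof.
move=> xa ya; apply/eqP; rewrite -subr_eq0; apply/eqP/form_csa_eq0.
  rewrite memvB ?memvZ ?form_dual_csa // -weight0 -(subrr alpha).
  exact: weight_lie.
move=> H hH; rewrite linearB linearZ !lfun_simp form_dualE //.
rewrite (form_invariant (rd_formP rd)) lieC (lie_weight ya) //.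
rewrite linearN linearZ /= csa_evalN scaleNr opprK.
by rewrite -[X in X - _]mulrC subrr.
Qed.

(** The form is nondegenerate and pairs [g_alpha] only with [g_(-alpha)]. *)
Lemma opposite_weight alpha x : x \in root_space alpha -> x != 0 ->
  exists2 y, y \in root_space (- alpha) & B x y = 1.
Proof.
move=> xa x0.
suff [y ya Bxy0] : exists2 y, y \in root_space (- alpha) & B x y != 0.
  exists ((B x y)^-1 *: y); first exact: memvZ.
  by rewrite linearZ; exact: mulVf.
apply: contrapT => noy; case/eqP: x0; apply: form_eq0.
apply: (weight_ext (U := K^o) (f := B x) (f' := fun=> 0)) => [||beta y yb].
- exact: linearP.
- by move=> a u v; rewrite scaler0 addr0.
have [ab0|ab0] := eqVneq (alpha + beta) 0; last exact: form_weight0 ab0.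
apply/eqP/contraT => Bxy0; case: noy; exists y => //.
by rewrite -(addKr alpha beta) ab0 addr0 in yb.
Qed.

(** In characteristic zero the weights of a string are distinct, while only
    finitely many weights occur. *)
Lemma weight_string_finite alpha beta : alpha != 0 ->
  exists k, root_space (beta + alpha *+ k) = 0%VS.
Proof.
move=> a0; apply: contrapT => nok.
pose s := [seq beta + alpha *+ k | k <- iota 0 (size (rd_roots rd)).+2].
have uniq_s : uniq s.
  rewrite map_inj_in_uniq ?iota_uniq // => i j _ _ /addrI eq_ij.
  have [H _ aH0] := csa_dual_neq0 a0; apply/eqP.
  rewrite -(eqr_nat K) -(inj_eq (mulfI aH0)) !mulr_natr.
  by rewrite -!csa_evalMn eq_ij.
suff /(uniq_leq_size uniq_s) : {subset s <= 0 :: rd_roots rd}.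
  by rewrite size_map size_iota /= ltnn.
move=> _ /mapP[k _ ->]; rewrite inE rd_rootsP unfold_in /is_root.
case: eqVneq => //= _; apply/eqP => k0.
by case: nok; exists k.
Qed.

Section RootString.
Variables (alpha : hdual) (x y : g).
Hypotheses (alpha0 : alpha != 0) (xa : x \in root_space alpha)
  (ya : y \in root_space (- alpha)).

Lemma weight_iter beta z k : z \in root_space beta ->
  iter k (lie x) z \in root_space (beta + alpha *+ k).
Proof.
move=> zb; elim: k => [|k IHk]; first by rewrite addr0.
by rewrite iterS mulrS addrCA; apply: weight_lie.
Qed.

Lemma lie_csa : lie x y \in h.
Proof. by rewrite -weight0 -(subrr alpha); apply: weight_lie. Qed.

(** With [t] the bracket of [x] and [y], lowering the [n]-th vector of the
    string of [z] multiplies the previous one by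
    [- n (beta + (n - 1) alpha / 2)(t)].  The string is finite, hence one of
    these factors vanishes. *)
Lemma lowest_weight beta z :
    z \in root_space beta -> z != 0 -> lie y z = 0 ->
  exists m, 2 * ev beta (lie x y) = - (m%:R * ev alpha (lie x y)).
Proof.
move=> zb z0 yz0; set t := lie x y; set b := ev beta t; set a := ev alpha t.
have lower n : 2 *: lie y (iter n.+1 (lie x) z) =
    - (n.+1%:R * (2 * b + n%:R * a)) *: iter n (lie x) z.
  elim: n => [|n IHn].
    rewrite /= lie_lie yz0 linear0 addr0 [lie y x]lieC lieNl -/t.
    rewrite (lie_weight zb) ?lie_csa // scalerN scalerA mul0r addr0 mul1r.
    by rewrite scaleNr.
  rewrite iterS lie_lie [lie y x]lieC lieNl -/t.
  rewrite (lie_weight (weight_iter n.+1 zb)) ?lie_csa //.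
  have lin_x := lie_linearr x; rewrite scalerDr -[X in _ + X](linZ lin_x) IHn.
  rewrite (linZ lin_x) -iterS scalerN scalerA -scaleNr -scalerDl.
  congr (_ *: _); rewrite csa_evalD csa_evalMn -/a -/b -mulr_natr.
  by rewrite -!natr1; ring.
have exk : exists k, iter k (lie x) z == 0.
  have [k k0] := weight_string_finite beta alpha0; exists k.
  by rewrite -memv0 -k0 weight_iter.
have [[|m] m0 minm] := ex_minnP exk; first by rewrite m0 in z0.
exists m; have := lower m; rewrite (eqP m0) linear0 scaler0 => /esym/eqP.
rewrite scaler_eq0 oppr_eq0 mulf_eq0 pnatr_eq0 /= => /orP[/eqP|m1].
  by move/eqP; rewrite addr_eq0 => /eqP.
by have := minm _ m1; rewrite ltnn.
Qed.

End RootString.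
End Weights.

(** * Root strings and the Killing form *)

Section Killing.
Variables (K : numClosedFieldType) (g : lieAlgType K) (rd : root_datum g).
Local Notation B := (rd_form rd).
Local Notation h := (rd_csa rd).
Local Notation hdual := (csa_dual h).
Local Notation root_space := (@root_space K g h).
Local Notation ev := (@csa_eval K g h).
Local Notation dual := (@form_dual K g rd).
Local Notation simple := (rd_simple rd).
Implicit Types (alpha beta gamma : hdual) (x y z u v H : g).

(** Going down the string of a vector of weight [gamma] ends in a vector of
    weight [gamma - m alpha] to which [lowest_weight] applies. *)
Lemma weight_ratio alpha gamma x y : alpha != 0 ->
    x \in root_space alpha -> y \in root_space (- alpha) ->
    root_space gamma != 0%VS ->
  exists n : int, 2 * ev gamma (lie x y) = n%:~R * ev alpha (lie x y).
Proof.
move=> a0 xa ya; rewrite -vpick0; set z := vpick _ => z0.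
have zc : z \in root_space gamma by apply: memv_pick.
have exk : exists k, iter k (lie y) z == 0.
  have [|k k0] := @weight_string_finite _ _ rd (- alpha) gamma.
    by rewrite oppr_eq0.
  by exists k; rewrite -memv0 -k0 weight_iter.
have [[|m] m0 minm] := ex_minnP exk; first by rewrite m0 in z0.
have zm0 : iter m (lie y) z != 0.
  by apply: contraT; rewrite negbK => /minm; rewrite ltnn.
have [l lP] := lowest_weight a0 xa ya (weight_iter ya m zc) zm0 (eqP m0).
exists (2 *+ m - l%:R); move: lP; rewrite csa_evalD csa_evalMn csa_evalN.
move=> lP; rewrite rmorphB rmorphMn /= !rmorph_nat mulrBl -mulNr mulNr -lP.
by rewrite -[_ *+ m]mulr_natr; ring.
Qed.

Lemma simple_sum alpha :
  alpha = \sum_(i < size simple) coord (in_tuple simple) i alpha *: simple`_i.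
Proof.
exact: (coord_basis (X := in_tuple simple) (rd_simple_basis rd) (memvf _)).
Qed.

Lemma simple_root (i : 'I_(size simple)) :
  simple`_i != 0 /\ root_space simple`_i != 0%VS.
Proof.
have : simple`_i \in rd_roots rd by apply/rd_simple_roots/mem_nth.
by rewrite rd_rootsP unfold_in => /andP[].
Qed.

Lemma csa_eq0 H : H \in h ->
  (forall gamma, root_space gamma != 0%VS -> ev gamma H = 0) -> H = 0.
Proof.
move=> hH H0; apply: (@form_csa_eq0 _ _ rd) => // H' hH'.
rewrite (form_sym (rd_formP rd)) (form_dualK hH') form_dualE //.
rewrite (simple_sum (csa_form _ _ _)) csa_eval_sum big1 // => i _.
by rewrite H0 ?mulr0 //; case: (simple_root i).
Qed.

(** Were [alpha(h_alpha)] zero, [weight_ratio] would put [h_alpha] in the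
    kernel of every weight. *)
Lemma root_norm_neq0 alpha : alpha != 0 -> root_space alpha != 0%VS ->
  ev alpha (dual alpha) != 0.
Proof.
move=> a0; rewrite -vpick0; set x := vpick _ => x0.
have xa : x \in root_space alpha by apply: memv_pick.
have [y ya Bxy] := opposite_weight xa x0.
have xyE : lie x y = dual alpha by rewrite (lie_opposite xa ya) Bxy scale1r.
apply/eqP => aa0; case/eqP: (a0); apply: (@form_dual_eq0 _ _ rd).
apply: csa_eq0 => [|gamma gamma0]; first exact: form_dual_csa.
have [n /eqP] := weight_ratio a0 xa ya gamma0.
by rewrite xyE aa0 mulr0 mulf_eq0 pnatr_eq0 => /eqP.
Qed.

(** A vector of [g_alpha] orthogonal to [y] is killed by [y], so it is the
    bottom of its string; were it nonzero, [lowest_weight] would make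
    [alpha(h_alpha)] a nonpositive multiple of itself. *)
Lemma root_space_line alpha x y z : alpha != 0 ->
  x \in root_space alpha -> y \in root_space (- alpha) -> B x y = 1 ->
  z \in root_space alpha -> z = B z y *: x.
Proof.
move=> a0 xa ya Bxy za; apply/eqP; rewrite -subr_eq0; apply: contraT => z'0.
have z'a : z - B z y *: x \in root_space alpha by rewrite memvB ?memvZ.
have xyE : lie x y = dual alpha by rewrite (lie_opposite xa ya) Bxy scale1r.
have Bz'y : B (z - B z y *: x) y = 0.
  rewrite linearB linearZ add_lfunE opp_lfunE scale_lfunE Bxy.
  by apply/eqP; rewrite subr_eq0 [_ *: _]mulr1.
have [|m /eqP] := lowest_weight a0 xa ya z'a z'0.
  by rewrite lieC (lie_opposite z'a ya) Bz'y scale0r oppr0.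
rewrite -addr_eq0 -mulrDl -natrD mulf_eq0 pnatr_eq0 /= xyE.
rewrite (negPf (root_norm_neq0 _ _)) //.
by apply: contraNneq z'0 => ga0; rewrite -memv0 -ga0.
Qed.

(** Values of weights on the coroots are rational, so complex conjugation of
    the coordinates of [H] on the coroots conjugates the values of all weights:
    the trace form pairs [H] and its conjugate to a sum of squared absolute
    values. *)
Lemma weight_sum_nondegenerate n (w : 'I_n -> hdual) H :
    (forall i, root_space (w i) != 0%VS) ->
    (forall gamma, root_space gamma != 0%VS -> exists i, gamma = w i) ->
    H \in h -> {in h, forall H', \sum_i ev (w i) H * ev (w i) H' = 0} ->
  H = 0.
Proof.
move=> w0 wP hH KH0.
pose q (i : 'I_(size simple)) := ev simple`_i (dual simple`_i).
have q0 i : q i != 0 by have [? ?] := simple_root i; apply: root_norm_neq0.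
pose a := fun i => coord (in_tuple simple) i (csa_form B h (vsproj h H)).
have lin_dual : linear dual := @form_dual_linear _ _ rd.
have HE : H = \sum_i a i *: dual simple`_i.
  rewrite [LHS](form_dualK hH) [X in dual X]simple_sum.
  rewrite (lin_sum lin_dual); apply: eq_bigr => i _.
  by rewrite (linZ lin_dual).
(* [a i * q i / 2] is the coordinate of [H] on the coroot
   [(2 / q i) *: dual simple`_i], and [H'] has the conjugate coordinates. *)
pose H' := \sum_i ((a i * q i)^* / q i) *: dual simple`_i.
have hH' : H' \in h.
  by rewrite memv_suml // => i _; rewrite memvZ ?form_dual_csa.
have conjE gamma : root_space gamma != 0%VS -> ev gamma H' = (ev gamma H)^*.
  move=> gamma0; rewrite HE /H' !(lin_sum (csa_eval_linear gamma)) rmorph_sum.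
  apply: eq_bigr => i _; rewrite !(linZ (csa_eval_linear gamma)).
  have [i0 gi0] := simple_root i; rewrite -vpick0 in gi0.
  have [y ya Bxy] := opposite_weight (memv_pick _) gi0.
  have [n'] := weight_ratio i0 (memv_pick _) ya gamma0.
  rewrite (lie_opposite (memv_pick _) ya) Bxy scale1r -/(q i) => gE.
  have {gE} -> : ev gamma (dual simple`_i) = n'%:~R / 2 * q i.
    apply: (mulfI (_ : 2 != 0)); first by rewrite pnatr_eq0.
    by rewrite gE mulrCA mulrA -[_ / 2 * _]mulrA; field.
  have ratE : (n'%:~R / 2)^* = n'%:~R / 2 :> K.
    by rewrite rmorphM fmorphV /= rmorph_int rmorph_nat.
  transitivity ((n'%:~R / 2)^* * (a i * q i)^*).
    by rewrite ratE [LHS]mulrCA divfK.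
  by rewrite -rmorphM; congr (_^*); rewrite [RHS]mulrCA.
apply: csa_eq0 => // gamma gamma0; have [i ->] := wP gamma gamma0.
have /eqP := KH0 _ hH'.
rewrite psumr_eq0 => [|j _]; last by rewrite conjE // mul_conjC_ge0.
move/allP => /(_ i); rewrite mem_index_enum => /(_ isT).
by rewrite /= conjE // mul_conjC_eq0 => /eqP.
Qed.

Lemma ad_linear : linear (@ad K g).
Proof.
move=> a x y; apply/lfunP => z.
by rewrite add_lfunE scale_lfunE !adE lieDl lieZl.
Qed.

(** The component of weight zero: the other weight spaces are orthogonal to [h]
    for every invariant form. *)
Lemma csa_part z : exists2 z0, z0 \in h
  & forall F, invariant_bilinear F -> {in h, forall H, F z H = F z0 H}.
Proof.
have [e basis_e [w eP]] := weight_basis rd.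
pose c i := coord e i z.
exists (\sum_(i < \dim {:g} | w i == 0) c i *: e`_i).
  rewrite memv_suml // => i /eqP wi0; rewrite memvZ // -(weight0 rd) -wi0.
  exact: eP.
move=> F invF H hH; have [[linl _] _] := invF.
rewrite {1}(coord_basis basis_e (memvf z)) !(lin_sum (linl H)).
rewrite [RHS]big_mkcond; apply: eq_bigr => i _; case: eqP => // /eqP wi0.
rewrite (linZ (linl H)) (weight_form0 invF (eP i) (csa_weight0 hH)) ?addr0 //.
by rewrite scaler0.
Qed.

Lemma comp_lfunBl (f f' k : 'End(g)) :
  ((f - f') \o k = (f \o k) - (f' \o k))%VF.
Proof. by rewrite comp_lfunDl comp_lfunNl. Qed.

Lemma comp_lfunBr (f k k' : 'End(g)) :
  (f \o (k - k') = (f \o k) - (f \o k'))%VF.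
Proof. by rewrite comp_lfunDr comp_lfunNr. Qed.

(** The functional [y |-> tr (D o ad y)] is represented by some [X] for the
    Killing form.  For [E = D - ad X] one gets
    [tr (ad (E x) o ad y) = tr (E o ad [x, y]) = 0], so [E x = 0]. *)
Lemma derivation_inner (D : 'End(g)) : derivation D -> exists X, D = ad X.
Proof.
move=> derD; have [e basis_e [w eP]] := weight_basis rd.
have e0 (i : 'I_(\dim {:g})) : e`_i != 0.
  by rewrite (free_not0 (basis_free basis_e)) ?mem_nth ?size_tuple.
pose tr := endo_trace e; have lin_tr := endo_trace_linear e.
pose Kil u v := tr (ad u \o ad v)%VF.
have bilK : bilinear_form Kil.
  split=> [v a u u'|u a v v']; rewrite /Kil ad_linear.
    by rewrite comp_lfunDl -comp_lfunZl -lin_tr.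
  by rewrite comp_lfunDr -comp_lfunZr -lin_tr.
have trB f f' : tr (f - f') = tr f - tr f' by apply: (linB lin_tr).
have invK : invariant_bilinear Kil.
  split=> // y u v; rewrite /Kil !ad_lie comp_lfunBl comp_lfunBr !trB.
  have -> : tr (ad u \o (ad v \o ad y))%VF = tr ((ad y \o ad u) \o ad v)%VF.
    by rewrite /tr comp_lfunA (endo_traceC basis_e) comp_lfunA.
  by rewrite -(comp_lfunA (ad u) (ad y)) addrA subrK subrr.
(* As the Killing form is nondegenerate on [h], the elements of its radical
   have no component in [h]. *)
have radB z : (forall y, Kil z y = 0) -> {in h, forall H, B z H = 0}.
  move=> Kz0 H hH; have [z0 hz0 z0P] := csa_part z.
  rewrite (z0P _ (form_invariant_bilinear rd)) //.
  suff -> : z0 = 0 by rewrite linear0 lfunE.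
  apply: (weight_sum_nondegenerate (w := fun i : 'I_(\dim {:g}) => w i)) => //.
    by move=> i; apply: contraTneq (e0 i) => wi0; rewrite -memv0 -wi0 eP.
  move=> gamma; rewrite -vpick0 => x0.
    have [y ya Bxy] := opposite_weight (memv_pick _) x0.
    apply: contrapT => now; case/negP: (oner_neq0 K).
    rewrite -Bxy [vpick _](coord_basis basis_e (memvf _)) linear_sum sum_lfunE.
    rewrite big1 // => i _; rewrite linearZ scale_lfunE.
    rewrite (form_weight0 (eP i) ya) ?scaler0 // subr_eq0.
    by apply/eqP => wi; apply: now; exists i.
  move=> H' hH'; rewrite -[RHS](Kz0 H') (z0P _ invK) // /Kil.
  apply/esym/endo_trace_diag => // i.
  rewrite comp_lfunE !adE (lie_weight (eP i)) // linearZ /=.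
  by rewrite (lie_weight (eP i)) // scalerA mulrC.
(* The bracket of [x] with a vector of weight [beta] is again in the radical,
   and pairing it with [h] recovers the component of [x] of weight [- beta]. *)
have ndK x : (forall y, Kil x y = 0) -> x = 0.
  move=> Kx0; apply: (@form_eq0 _ _ rd).
  apply: (@weight_ext _ _ rd K^o (B x) (fun=> 0)) => [||beta y yb].
  - exact: linearP.
  - by move=> a u v; rewrite scaler0 addr0.
  have [b0|/csa_dual_neq0[H hH bH0]] := eqVneq beta 0.
    by apply: (radB x Kx0 y); rewrite -(weight0 rd) -b0.
  have Kyx0 v : Kil (lie y x) v = 0.
    by have [_ /(_ y x v)] := invK; rewrite Kx0 addr0.
  have := radB _ Kyx0 H hH.
  rewrite form_lie lieC (lie_weight yb) // linearN linearZ opprK => /eqP.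
  by rewrite mulf_eq0 (negPf bH0) => /eqP.
have [|X XP] := nondegenerate_represents (phi := fun y => tr (D \o ad y)%VF)
    bilK ndK.
  by move=> a u v; rewrite ad_linear comp_lfunDr -comp_lfunZr /tr lin_tr.
exists X; apply/lfunP => x; apply/eqP; rewrite -subr_eq0; apply/eqP/ndK => y.
pose E := D - ad X.
have trE u : tr (E \o ad u)%VF = 0 by rewrite comp_lfunBl trB -XP subrr.
have -> : D x - ad X x = E x by rewrite /E !lfun_simp.
have -> : Kil (E x) y = tr (E \o ad (lie x y))%VF; last exact: trE.
have derE u v : E (lie u v) = lie (E u) v + lie u (E v).
  rewrite !add_lfunE !opp_lfunE derD derivation_ad opprD addrACA lieDl lieNl.
  by rewrite linearB.
have adEx : ad (E x) = ((E \o ad x) - (ad x \o E))%VF.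
  by apply/lfunP => v; rewrite add_lfunE opp_lfunE !comp_lfunE !adE derE addrK.
rewrite /Kil adEx ad_lie comp_lfunBl comp_lfunBr !trB -!comp_lfunA.
by congr (_ - _); rewrite /tr endo_traceC // comp_lfunA.
Qed.

End Killing.

(** * Invariant forms and the Belavin-Drinfeld order *)

Section RootDatum.
Variables (K : numClosedFieldType) (g : lieAlgType K) (rd : root_datum g).
Local Notation B := (rd_form rd).
Local Notation h := (rd_csa rd).
Local Notation hdual := (csa_dual h).
Local Notation root_space := (@root_space K g h).
Local Notation ev := (@csa_eval K g h).
Local Notation dual := (@form_dual K g rd).
Local Notation simple := (rd_simple rd).
Local Notation pos := (positive_roots rd).
Implicit Types (alpha beta gamma : hdual) (y z u v H : g).

(** In terms of the form, such an [S] is an operator that commutes with all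
    [ad y] and is skew.  It multiplies [g_alpha] and [g_(-alpha)] by the same
    scalar, being compatible with the bracket into [h], and by opposite
    scalars, being skew. *)
Lemma invariant_skew_eq0 (S : g -> g -> K) : invariant_bilinear S ->
  (forall u v, S u v = - S v u) -> forall u v, S u v = 0.
Proof.
move=> invS skewS; have [[linl linr] S_lie] := invS.
have lin_0 : linear ((fun=> 0) : g -> K^o).
  by move=> a u v; rewrite scaler0 addr0.
have S_dual alpha u v H : u \in root_space alpha ->
    v \in root_space (- alpha) -> H \in h ->
    B u v * S (dual alpha) H = ev alpha H * S v u.
  move=> ua va hH; apply/eqP; rewrite -subr_eq0 -(S_lie u v H).
  rewrite (lie_opposite ua va) [lie u H]lieC (lie_weight ua) //.
  by rewrite (linZ (linl H)) (linN (linr v)) (linZ (linr v)).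
have S_root alpha u v : alpha != 0 -> u \in root_space alpha ->
    v \in root_space (- alpha) -> S u v = 0.
  move=> a0 ua va; have [H hH aH0] := csa_dual_neq0 a0.
  have vNa : u \in root_space (- - alpha) by rewrite opprK.
  have := S_dual _ _ _ _ va vNa hH; have := S_dual _ _ _ _ ua va hH.
  rewrite (linN (@form_dual_linear _ _ rd)) (linN (linl H)).
  rewrite (form_sym (rd_formP rd) v u) mulrN => ->.
  rewrite csa_evalN mulNr => /oppr_inj /(mulfI aH0).
  by rewrite skewS => /eqP; rewrite eq_sym -addr_eq0 -mulr2n mulrn_eq0 => /eqP.
have S_csa alpha H : alpha != 0 -> root_space alpha != 0%VS -> H \in h ->
    S (dual alpha) H = 0.
  move=> a0; rewrite -vpick0 => x0 hH.
  have [y ya Bxy] := opposite_weight (memv_pick _) x0.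
  have := S_dual _ _ _ _ (memv_pick _) ya hH.
  by rewrite Bxy mul1r (skewS y) (S_root _ _ _ a0 (memv_pick _) ya) oppr0 mulr0.
move=> u v.
apply: (@weight_ext _ _ rd K^o (S^~ v) (fun=> 0)) => // alpha {}u ua.
apply: (@weight_ext _ _ rd K^o (S u) (fun=> 0)) => // beta {}v vb.
have [ab0|] := eqVneq (alpha + beta) 0; last exact: weight_form0 vb.
have bE : beta = - alpha by apply/eqP; rewrite -addr_eq0 addrC ab0.
have [a0|a0] := eqVneq alpha 0; last by apply: S_root ua _; rewrite -?bE.
have hu : u \in h by rewrite -(weight0 rd) -a0.
have hv : v \in h by rewrite -(weight0 rd) -oppr0 -a0 -bE.
have lin_dual : linear dual := @form_dual_linear _ _ rd.
rewrite (form_dualK hu) (simple_sum (csa_form _ _ _)) (lin_sum lin_dual).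
rewrite (lin_sum (linl v)) big1 // => i _; have [i0 gi0] := simple_root i.
by rewrite (linZ lin_dual) (linZ (linl v)) S_csa ?scaler0.
Qed.

(** The height is the case [phi = 1]; the values [phi = tau_depth] below order
    the roots along [tau]. *)
Definition simple_functional (phi : hdual -> K) alpha : K :=
  \sum_(i < size simple) coord (in_tuple simple) i alpha * phi simple`_i.

Lemma simple_functional_linear phi :
  linear (simple_functional phi : hdual -> K^o).
Proof.
move=> a alpha beta.
transitivity (\sum_(i < size simple)
  (a * (coord (in_tuple simple) i alpha * phi simple`_i)
   + coord (in_tuple simple) i beta * phi simple`_i)).
  by apply: eq_bigr => i _; rewrite linearP mulrA -mulrDl.
by rewrite big_split /= -mulr_sumr.
Qed.

Lemma simple_functionalE phi alpha : alpha \in simple ->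
  simple_functional phi alpha = phi alpha.
Proof.
move=> /(nthP 0)[i lt_i <-].
rewrite /simple_functional (bigD1 (Ordinal lt_i)) //=.
have free_s : free (in_tuple simple) := basis_free (rd_simple_basis rd).
have cE j : coord (in_tuple simple) j simple`_i = (j == Ordinal lt_i)%:R.
  by rewrite eq_sym -(coord_free (Ordinal lt_i) j free_s).
rewrite big1 => [|j /negPf nj]; last by rewrite cE nj mul0r.
by rewrite cE eqxx mul1r addr0.
Qed.

Lemma simple_functional_sum phi (S : seq hdual) (f : hdual -> hdual)
    (k : hdual -> int) : {in S, forall s, f s \in simple} ->
  simple_functional phi (\sum_(s <- S) f s *~ k s)
  = \sum_(s <- S) phi (f s) *~ k s.
Proof.
move=> sS; rewrite (lin_sum (simple_functional_linear phi)).
rewrite !big_seq; apply: eq_bigr => s Ss.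
rewrite -scaler_int (linZ (simple_functional_linear phi)).
by rewrite simple_functionalE ?sS // [LHS]mulrzl.
Qed.

Local Notation height := (simple_functional (fun=> 1)).

Lemma nat_span_functional (N : hdual -> nat) alpha : nat_span simple alpha ->
  exists n : nat, simple_functional (fun s => (N s)%:R) alpha = n%:R.
Proof.
case=> k ->; exists (\sum_(s <- simple) N s * k s)%N.
transitivity (\sum_(s <- simple) (N s)%:R *~ k s : K).
  exact: (@simple_functional_sum (fun s => (N s)%:R) simple id
    (fun s => Posz (k s)) (fun s sS => sS)).
by rewrite natr_sum; apply: eq_bigr => s _; rewrite natrM mulr_natr.
Qed.

Lemma pos_height alpha : nat_span simple alpha -> alpha != 0 ->
  0 < height alpha.
Proof.
case=> k -> a0.
have hE : height (\sum_(s <- simple) s *+ k s) = (\sum_(s <- simple) k s)%:R.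
  rewrite natr_sum; exact: (@simple_functional_sum (fun=> 1) simple id
    (fun s => Posz (k s)) (fun s sS => sS)).
rewrite hE ltr0n lt0n; apply: contraNneq a0 => /eqP.
rewrite sum_nat_seq_eq0 => /allP k0; rewrite big_seq big1 // => s /k0.
by rewrite implyTb => /eqP ->.
Qed.

Lemma posP alpha : alpha \in pos -> [/\ alpha \in rd_roots rd, alpha != 0,
  root_space alpha != 0%VS & nat_span simple alpha].
Proof.
rewrite mem_filter => /andP[/asboolP spana ra]; split=> //.
  by move: ra; rewrite rd_rootsP unfold_in => /andP[].
by move: ra; rewrite rd_rootsP unfold_in => /andP[].
Qed.

Lemma pos_uniq : uniq pos.
Proof. by rewrite filter_uniq // rd_roots_uniq. Qed.

Lemma pos_add_neq0 alpha beta : alpha \in pos -> beta \in pos ->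
  alpha + beta != 0.
Proof.
move=> /posP[_ a0 _ /pos_height/(_ a0) ha] /posP[_ b0 _ /pos_height/(_ b0) hb].
apply: contraTneq (addr_gt0 ha hb) => ab0.
rewrite -(linD (simple_functional_linear _)) ab0.
by rewrite (lin0 (simple_functional_linear _)) ltxx.
Qed.

Lemma simple_pos alpha : alpha \in simple -> alpha \in pos.
Proof.
move=> sa; rewrite mem_filter rd_simple_roots // andbT; apply/asboolP.
exists (fun s => (s == alpha) : nat).
rewrite (bigD1_seq alpha) ?free_uniq ?(basis_free (rd_simple_basis rd)) //=.
by rewrite eqxx big1 ?addr0 // => s /negPf ->.
Qed.

Lemma root_opp alpha : alpha \in rd_roots rd -> - alpha \in rd_roots rd.
Proof.
rewrite !rd_rootsP !unfold_in /is_root oppr_eq0 => /andP[-> ] /=.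
rewrite -vpick0 => x0; have [y ya Bxy] := opposite_weight (memv_pick _) x0.
apply: contraTneq (oner_neq0 K) => ga0; rewrite negbK -Bxy.
by move: ya; rewrite ga0 memv0 => /eqP ->; rewrite linear0.
Qed.

Lemma root_pos alpha : alpha \in rd_roots rd ->
  alpha \in pos \/ - alpha \in pos.
Proof.
move=> ra; have [spana|spana] := rd_simple_span ra; [left|right].
  by rewrite mem_filter ra andbT; apply/asboolP.
by rewrite mem_filter root_opp // andbT; apply/asboolP.
Qed.

Section RootVectors.
Variable x : hdual -> g.
Hypothesis x_root : root_vectors x.

Lemma root_vectorP alpha : alpha \in rd_roots rd ->
  [/\ x alpha \in root_space alpha, x (- alpha) \in root_space (- alpha)
    & B (x alpha) (x (- alpha)) = 1].
Proof.
have [xP x1] := x_root => ra; split; rewrite ?xP ?root_opp //.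
have [pa|pa] := root_pos ra; first exact: x1.
by rewrite (form_sym (rd_formP rd)) -{2}[alpha]opprK x1.
Qed.

Lemma form_root_vectors alpha beta : alpha \in rd_roots rd ->
  beta \in rd_roots rd -> B (x alpha) (x (- beta)) = (alpha == beta)%:R.
Proof.
move=> ra rb; have [xa _ x1] := root_vectorP ra.
have [_ xb _] := root_vectorP rb.
case: eqVneq => [<-|ab] //.
by rewrite (form_weight0 xa xb) // subr_eq0.
Qed.

Lemma form_pos0 alpha beta : alpha \in pos -> beta \in pos ->
  B (x alpha) (x beta) = 0.
Proof.
move=> pa pb; have [/root_vectorP[xa _ _] _ _ _] := posP pa.
have [/root_vectorP[xb _ _] _ _ _] := posP pb.
by rewrite (form_weight0 xa xb) // pos_add_neq0.
Qed.

Lemma form_neg0 alpha beta : alpha \in pos -> beta \in pos ->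
  B (x (- alpha)) (x (- beta)) = 0.
Proof.
move=> pa pb; have [/root_vectorP[_ xa _] _ _ _] := posP pa.
have [/root_vectorP[_ xb _] _ _ _] := posP pb.
by rewrite (form_weight0 xa xb) // -opprD oppr_eq0 pos_add_neq0.
Qed.

(** For [H] in [h] and a root vector [z], [B (lie H X) z] is a multiple of
    [B X z].  Thus [X] commutes with [h], which is its own centralizer. *)
Lemma csa_of_orthogonal X :
  {in pos, forall alpha, B X (x alpha) = 0 /\ B X (x (- alpha)) = 0} ->
  X \in h.
Proof.
move=> X0; rewrite -(weight0 rd); apply/root_spaceP => H hH.
rewrite csa_eval0 scale0r; apply: (@form_eq0 _ _ rd).
apply: (@weight_ext _ _ rd K^o (B (lie H X)) (fun=> 0)).
- exact: linearP.
- by move=> a u v; rewrite scaler0 addr0.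
move=> alpha z za; rewrite form_lie (lie_weight za) // linearZ /=.
have [->|a0] := eqVneq alpha 0; first by rewrite csa_eval0 scale0r oppr0.
suff -> : B X z = 0 by rewrite scaler0 oppr0.
have [->|z0] := eqVneq z 0; first by rewrite linear0.
have ra : alpha \in rd_roots rd.
  rewrite rd_rootsP unfold_in /is_root a0.
  by apply: contraNneq z0 => ga0; rewrite -memv0 -ga0.
have [xa xNa x1] := root_vectorP ra.
rewrite (root_space_line a0 xa xNa x1 za) linearZ /=.
have -> : B X (x alpha) = 0; last by rewrite scaler0.
have [/X0[]//|/X0[_]] := root_pos ra.
by rewrite opprK.
Qed.

End RootVectors.

Section Triple.
Variable T : bd_triple rd.
Local Notation tau := (bd_tau T).
Local Notation dom := (bd_dom T).

Lemma tau_simple : {in dom, forall s, tau s \in simple}.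
Proof.
move=> s ds; apply: (@bd_cod_simple _ _ _ T); rewrite -bd_tau_im.
exact: map_f.
Qed.

Lemma tau_exits s : exists n, iter n tau s \notin dom.
Proof.
have [/bd_tau_nilpotent[n [_ _ _ ?]]|ds] := boolP (s \in dom); last by exists 0.
by exists n.
Qed.

Definition tau_depth s := ex_minn (tau_exits s).

Lemma tau_depthS s : s \in dom -> tau_depth s = (tau_depth (tau s)).+1.
Proof.
move=> ds; rewrite /tau_depth.
case: ex_minnP => [[|m]]; first by rewrite ds.
rewrite iterSr => m_out minm; case: ex_minnP => n n_out minn.
apply/eqP; rewrite eqSS eqn_leq minn // andbT.
by rewrite -ltnS minm // iterSr.
Qed.

Local Notation depth := (simple_functional (fun s => (tau_depth s)%:R)).

(** Since [tau] sends simple roots to simple roots of depth one less, it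
    keeps the height and lowers the depth by the height.  As heights of positive
    roots are positive, this makes [bd_prec] acyclic. *)
Lemma tau_iter_depth n alpha beta : tau_iter T n alpha beta ->
  height beta = height alpha /\ depth beta = depth alpha - n%:R * height alpha.
Proof.
elim: n alpha => [|n IHn] alpha /=; first by move=> ->; rewrite mul0r subr0.
case=> gamma [k [aE gE]] /IHn[-> ->].
have hE : height gamma = height alpha.
  rewrite aE gE !simple_functional_sum //; first exact: bd_dom_simple.
  exact: tau_simple.
have dE : depth gamma = depth alpha - height alpha.
  rewrite aE gE !simple_functional_sum;
    [|exact: bd_dom_simple|exact: bd_dom_simple|exact: tau_simple].
  rewrite -sumrB !big_seq; apply: eq_bigr => s /tau_depthS ->.
  by rewrite -mulrzBl -natr1 addrK.
by rewrite hE dE; split=> //; rewrite -natr1; ring.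
Qed.

Lemma bd_prec_rank : exists rank : hdual -> nat, forall alpha beta,
  bd_prec T alpha beta -> (rank beta < rank alpha)%N.
Proof.
have /choice[rank rankP] : forall alpha, exists n : nat,
    nat_span simple alpha -> depth alpha = n%:R.
  move=> alpha; have [spana|nospan] := pselect (nat_span simple alpha).
    by have [n nE] := nat_span_functional (tau_depth) spana; exists n.
  by exists 0.
exists rank => alpha beta.
move=> [[/posP[_ a0 _ spana] _] [/posP[_ _ _ spanb] _] [n n0]].
move=> /tau_iter_depth[_ dE].
rewrite -(ltr_nat K) -!rankP // dE.
by rewrite ltrBlDr ltrDl mulr_gt0 ?ltr0n ?pos_height.
Qed.

Lemma tau_prec alpha : alpha \in dom -> bd_prec T alpha (tau alpha).
Proof.
move=> da.
have sum_id (S : seq hdual) (f : hdual -> hdual) s : uniq S -> s \in S ->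
    f s = \sum_(s' <- S) f s' *~ (s' == s : nat).
  move=> uniqS sS; rewrite (bigD1_seq s) //= eqxx big1 ?addr0 //.
  by move=> s' /negPf ->; rewrite mulr0z.
have cb : tau alpha \in bd_cod T by rewrite -bd_tau_im map_f.
have sa : alpha \in simple := bd_dom_simple da.
split.
- split; first exact: simple_pos.
  exists (fun s => (s == alpha : nat) : int).
  exact: (sum_id dom id alpha (bd_dom_uniq T) da).
- split; first by apply/simple_pos/tau_simple.
  exists (fun s => (s == tau alpha : nat) : int).
  exact: (sum_id _ id _ (bd_cod_uniq T) cb).
- exists 1 => //; exists (tau alpha) => //.
  exists (fun s => (s == alpha : nat) : int); split.
    exact: (sum_id dom id alpha (bd_dom_uniq T) da).
  exact: (sum_id dom tau alpha (bd_dom_uniq T) da).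
Qed.

End Triple.
End RootDatum.

(** * Pairings with the r-matrix *)

Lemma rank_ind (I : eqType) (s : seq I) (rank : I -> nat) (Q : I -> Prop) :
    {in s, forall i, {in s, forall j, (rank j < rank i)%N -> Q j} -> Q i} ->
  {in s, forall i, Q i}.
Proof.
move=> step i; have [n] := ubnP (rank i); elim: n i => // n IHn i lt_i si.
by apply: step => // j sj lt_j; apply: IHn => //; apply: leq_trans lt_j _.
Qed.

Lemma corank_ind (I : eqType) (s : seq I) (rank : I -> nat) (Q : I -> Prop) :
    {in s, forall i, {in s, forall j, (rank i < rank j)%N -> Q j} -> Q i} ->
  {in s, forall i, Q i}.
Proof.
move=> step; pose M := (\sum_(i <- s) rank i)%N.
have leM i : i \in s -> (rank i <= M)%N.
  by move=> si; rewrite /M (big_rem i) //= leq_addr.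
apply: (rank_ind (rank := fun i => M - rank i)%N) => i si IHi.
apply: step => // j sj lt_j; apply: IHi => //.
by rewrite ltn_sub2l // (leq_trans lt_j) ?leM.
Qed.

Section RMatrix.
Variables (K : numClosedFieldType) (g : lieAlgType K) (rd : root_datum g).
Local Notation B := (rd_form rd).
Local Notation h := (rd_csa rd).
Local Notation hdual := (csa_dual h).
Local Notation root_space := (@root_space K g h).
Local Notation ev := (@csa_eval K g h).
Local Notation dual := (@form_dual K g rd).
Local Notation pos := (positive_roots rd).
Variable T : bd_triple rd.
Local Notation tau := (bd_tau T).
Local Notation dom := (bd_dom T).
Variables (r0 : tens (subvs_of h) (subvs_of h)) (x : hdual -> g).
Hypothesis r0P : continuous_parameter T r0.
Hypothesis x_root : root_vectors x.
Local Notation r := (bd_rmatrix T r0 x).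
Local Notation r0g := (tmap vsval vsval r0 : tens g g).
Implicit Types (alpha beta gamma : hdual) (y z u v H : g)
  (phi psi : 'Hom(g, K^o)).

Lemma csa_tens_sum : r0g = \sum_i \sum_j (r0 : 'M[K]_(_, _)) i j *:
  pure (vsval (vbasis {:subvs_of h})`_i) (vsval (vbasis {:subvs_of h})`_j).
Proof. by []. Qed.

Lemma tform_csa phi psi phi' psi' :
  {in h, phi =1 phi'} -> {in h, psi =1 psi'} ->
  tform r0g phi psi = tform r0g phi' psi'.
Proof.
move=> eq_phi eq_psi; rewrite csa_tens_sum.
rewrite !(lin_sum (tform_linear _ _)); apply: eq_bigr => i _.
rewrite !(lin_sum (tform_linear _ _)); apply: eq_bigr => j _.
rewrite !(linZ (tform_linear _ _)) !tform_pure.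
by rewrite eq_phi ?eq_psi ?subvsP.
Qed.

Lemma tform_csa0l phi psi : {in h, forall H, phi H = 0} ->
  tform r0g phi psi = 0.
Proof.
move=> phi0; rewrite (tform_csa (phi' := 0) (psi' := psi)) //.
  exact: (lin0 (tform_linearl _ _)).
by move=> H /phi0 ->; rewrite lfunE.
Qed.

Lemma tform_csa0r phi psi : {in h, forall H, psi H = 0} ->
  tform r0g phi psi = 0.
Proof.
move=> psi0; rewrite (tform_csa (phi' := phi) (psi' := 0)) //.
  exact: (lin0 (tform_linearr _ _)).
by move=> H /psi0 ->; rewrite lfunE.
Qed.

Lemma tform_tmap (t : tens g g) (f f' : 'End(g)) phi psi :
  tform (tmap f f' t) phi psi = tform t (phi \o f)%VF (psi \o f')%VF.
Proof.
refine (@tens_ext _ _ _ K^o (fun s => tform (tmap f f' s) phi psi)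
  (fun s => tform s (phi \o f)%VF (psi \o f')%VF) _ _ _ t) => [||v w].
- exact: linear_comp (tform_linear _ _) (tlift_linear _).
- exact: tform_linear.
by rewrite tmap_pure; try exact: linearP; rewrite !tform_pure !comp_lfunE.
Qed.

Lemma form_csa_proj H y : H \in h -> B H (csa_proj rd y) = B H y.
Proof.
move=> hH; pose W := (\sum_(alpha <- rd_roots rd) root_space alpha)%VS.
have WB H' : H' \in h -> (W <= lker (B H'))%VS.
  move=> hH'; rewrite /W big_seq.
  apply: (big_ind (fun U => (U <= lker (B H'))%VS)) => [|U V|alpha].
  - exact: sub0v.
  - by rewrite subv_add => -> ->.
  rewrite rd_rootsP unfold_in => /andP[a0 _].
  by apply/subvP => v va; rewrite memv_ker (form_csa0 hH' va).
have BW0 H' w : H' \in h -> w \in W -> B H' w = 0.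
  by move=> /WB/subvP sub_W /sub_W; rewrite memv_ker => /eqP.
have hW0 : (h :&: W = 0)%VS.
  apply/eqP; rewrite -subv0; apply/subvP => v /memv_capP[hv Wv].
  rewrite memv0; apply/eqP/(@form_csa_eq0 _ _ rd) => // H' hH'.
  by rewrite (form_sym (rd_formP rd)) BW0.
have hWf : (h + W)%VS = fullv.
  apply/eqP; rewrite eqEsubv subvf /=; apply/subvP => v _.
  have [e basis_e [w eP]] := weight_basis rd.
  rewrite (coord_basis basis_e (memvf v)) memv_suml // => i _; apply: memvZ.
  have [wi0|wi0] := eqVneq (w i) 0.
    by rewrite (subvP (addvSl _ _)) // -(weight0 rd) -wi0 eP.
  have [->|ei0] := eqVneq e`_i 0; first exact: mem0v.
  have ri : w i \in rd_roots rd.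
    rewrite rd_rootsP unfold_in /is_root wi0.
    by apply: contraNneq ei0 => gi0; rewrite -memv0 -gi0.
  apply: (subvP (addvSr _ _)).
  by rewrite /W (big_rem _ ri) (subvP (addvSl _ _)).
rewrite -{2}(daddv_pi_add (w := y) hW0) ?hWf ?memvf // linearD /=.
by rewrite (BW0 H (daddv_pi W h y)) ?memv_pi ?addr0.
Qed.

Lemma tform_casimir u v : tform (casimir B) (B u) (B v) = B u v.
Proof.
rewrite /casimir (lin_sum (tform_linear _ _)).
rewrite [v in RHS](coord_vbasis (memvf v)) linear_sum; apply: eq_bigr => i _.
rewrite tform_pure linearZ /= mulrC; congr (_ * _).
have lin_i : linear (coord (vbasis {:g}) i : g -> K^o) by apply: linearP.
have ndB y : (forall z, B y z = 0) -> y = 0 by apply: (@form_eq0 _ _ rd).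
have [y yP] := nondegenerate_represents (form_bilinear rd) ndB lin_i.
rewrite (form_sym (rd_formP rd)) limg_lfunVK ?linfunE //.
have -> : linfun (coord (vbasis {:g}) i : g -> K^o) = B y.
  by apply/lfunP => z; rewrite linfunE // yP.
by rewrite memv_img ?memvf.
Qed.

(** The diagonal of [r0 + r0^21 = Omega_0]: the form is symmetric and its
    Casimir element pairs to it. *)
Lemma tform_csa_diag H : H \in h -> 2 * tform r0g (B H) (B H) = B H H.
Proof.
move=> hH; have [_ sym_r0] := r0P.
have := congr1 (fun t => tform t (B H) (B H)) sym_r0.
rewrite (linD (tform_linear _ _)) tform_swap mulr_natl mulr2n => ->.
rewrite /casimir0 tform_tmap.
have -> : (B H \o csa_proj rd)%VF = B H.
  by apply/lfunP => z; rewrite comp_lfunE form_csa_proj.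
exact: tform_casimir.
Qed.

Lemma tform_rmatrix phi psi : tform r phi psi =
  tform r0g phi psi
  + \sum_(alpha <- pos) phi (x (- alpha)) * psi (x alpha)
  + \sum_(alpha <- pos) \sum_(beta <- pos | `[< bd_prec T alpha beta >])
      (phi (x (- alpha)) * psi (x beta) - phi (x beta) * psi (x (- alpha))).
Proof.
rewrite /bd_rmatrix !(linD (tform_linear _ _)) !(lin_sum (tform_linear _ _)).
congr (_ + _ + _); apply: eq_bigr => alpha _; first exact: tform_pure.
rewrite (lin_sum (tform_linear _ _)); apply: eq_bigr => beta _.
by rewrite (linB (tform_linear _ _)) !tform_pure.
Qed.

(** The equation [ad_X r = 0], paired with all [B u] and [B v]. *)
Definition fixes_rmatrix X := forall u v,
  tform r (B (lie X u)) (B v) + tform r (B u) (B (lie X v)) = 0.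

Lemma form_lie_comp y u : (B u \o ad y)%VF = - B (lie y u).
Proof.
apply/lfunP => z; rewrite comp_lfunE adE opp_lfunE form_lie opprK.
by rewrite (form_sym (rd_formP rd)).
Qed.

Lemma tform_tad (t : tens g g) y u v : tform (tad y t) (B u) (B v) =
  - (tform t (B (lie y u)) (B v) + tform t (B u) (B (lie y v))).
Proof.
rewrite tad_ad tform_tder !form_lie_comp (linN (tform_linearl _ _)).
by rewrite (linN (tform_linearr _ _)) opprD.
Qed.

(** From [ad_X ad_y r = ad_[X, y] r] follows [ad_y ad_X r = 0], so the form
    attached to [ad_X r] is invariant, and it is skew by assumption. *)
Lemma biderivation_fixes_rmatrix X :
    (forall y, tad X (tad y r) = tad (lie X y) r) ->
    tswap (tad X r) = - tad X r ->
  fixes_rmatrix X.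
Proof.
move=> codX skewX; set s := tad X r in skewX.
have tad_s y : tad y s = 0.
  by apply: (addrI (tad (lie X y) r)); rewrite addr0 -tad_lie codX.
suff s0 u v : tform s (B u) (B v) = 0.
  by move=> u v; apply/eqP; rewrite -oppr_eq0 -tform_tad s0.
apply: (@invariant_skew_eq0 _ _ rd (fun u v => tform s (B u) (B v))).
  split.
    split=> [w a y z|w a y z]; rewrite linearP.
      exact: (tform_linearl s).
    exact: (tform_linearr s).
  move=> y {}u {}v; apply/eqP; rewrite -oppr_eq0 -tform_tad tad_s.
  by rewrite (lin0 (tform_linear _ _)).
move=> {}u {}v; rewrite -(tform_swap s) skewX.
by rewrite (linN (tform_linear _ _)).
Qed.

Section Fixed.
Variable X : g.
Hypothesis fixX : fixes_rmatrix X.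

Lemma form_lie_csa H y alpha : H \in h -> y \in root_space alpha ->
  B (lie X H) y = ev alpha H * B X y.
Proof.
move=> hH ya; rewrite (form_invariant (rd_formP rd)) (lie_weight ya) //.
by rewrite linearZ.
Qed.

Lemma form_lie_root y alpha H : H \in h -> y \in root_space alpha ->
  B (lie X y) H = - (B X y * B (dual alpha) H).
Proof.
move=> hH ya; rewrite (form_invariant (rd_formP rd)) lieC (lie_weight ya) //.
by rewrite linearN linearZ /= form_dualE // mulrC.
Qed.

Lemma dual_norm_neq0 alpha : alpha \in pos -> B (dual alpha) (dual alpha) != 0.
Proof.
case/posP=> _ a0 ga0 _; rewrite form_dualE ?form_dual_csa //.
exact: root_norm_neq0.
Qed.

Lemma form_root_csa0 alpha : alpha \in rd_roots rd ->
  {in h, forall H, B (x alpha) H = 0}.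
Proof.
move=> ra H hH; have [xa _ _] := root_vectorP x_root ra.
rewrite (form_sym (rd_formP rd)) (form_csa0 hH xa) //.
by move: ra; rewrite rd_rootsP unfold_in => /andP[].
Qed.

Lemma form_csa_root0 alpha : alpha \in rd_roots rd ->
  {in h, forall H, B H (x alpha) = 0}.
Proof.
by move=> ra H hH; rewrite (form_sym (rd_formP rd)) form_root_csa0.
Qed.

Lemma tform_rmatrix_csa H v : H \in h ->
  tform r (B H) (B v) = tform r0g (B H) (B v).
Proof.
move=> hH; rewrite tform_rmatrix !big_seq !big1 ?addr0 // => alpha pa.
  rewrite big_seq_cond big1 // => beta /andP[pb _].
  have [/root_opp ra _ _ _] := posP pa; have [rb _ _ _] := posP pb.
  by rewrite (form_csa_root0 ra hH) (form_csa_root0 rb hH) !mul0r subrr.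
have [/root_opp ra _ _ _] := posP pa.
by rewrite (form_csa_root0 ra hH) mul0r.
Qed.

(** Pair with [h] and [x_(-gamma)], where [gamma] is minimal for [bd_prec] among
    the roots with [B X (x (- gamma)) <> 0].  With [c] this value, the equation
    becomes [c r0(H, h_gamma) = c gamma(H)], which for [H = h_gamma] contradicts
    [tform_csa_diag]. *)
Lemma negative_part0 : {in pos, forall gamma, B X (x (- gamma)) = 0}.
Proof.
have [rank rankP] := bd_prec_rank T.
apply: (corank_ind (rank := rank)) => gamma pg IH.
have [rg _ _ _] := posP pg; have [xg xNg x1] := root_vectorP x_root rg.
apply: contraTeq (dual_norm_neq0 pg) => c0; rewrite negbK.
set c := B X _ in c0.
have hd := form_dual_csa gamma; set H := dual gamma in hd *.
have := fixX H (x (- gamma)).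
rewrite (tform_rmatrix_csa _ hd).
rewrite (tform_csa (phi' := B H) (psi' := c *: B H)) //; last first.
  move=> H' hH'; rewrite (form_lie_root hH' xNg) scale_lfunE.
  by rewrite (linN (@form_dual_linear _ _ rd)) linearN opp_lfunE mulrN opprK.
rewrite (linZ (tform_linearr _ _)).
have -> : tform r (B (lie X H)) (B (x (- gamma))) = - (c * B H H).
  rewrite tform_rmatrix tform_csa0r; last exact/form_root_csa0/root_opp.
  rewrite (bigD1_seq gamma) ?pos_uniq //= (form_lie_csa hd xNg).
  rewrite (form_sym (rd_formP rd) (x (- gamma))) x1 mulr1 add0r.
  rewrite big_seq_cond big1 => [|alpha /andP[pa ag]]; last first.
    have [ra _ _ _] := posP pa.
    rewrite (form_sym (rd_formP rd) (x (- gamma))).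
    by rewrite (form_root_vectors x_root) // (negPf ag) mulr0.
  rewrite big_seq big1 => [|alpha pa].
    by rewrite !addr0 csa_evalN -form_dualE // mulNr mulrC.
  have [ra _ _ _] := posP pa; have [_ xNa _] := root_vectorP x_root ra.
  rewrite big_seq_cond big1 // => beta /andP[pb /asboolP ab].
  have [rb _ _ _] := posP pb.
  rewrite (form_neg0 x_root pg pa) mulr0 subr0.
  rewrite (form_sym (rd_formP rd) (x (- gamma))) (form_root_vectors x_root) //.
  case: eqVneq => [bg|_]; last by rewrite mulr0.
  by rewrite (form_lie_csa hd xNa) IH ?mulr0 ?mul0r // rankP // -bg.
rewrite addrC [_ *: _]mulrC -[c * B H H]mulrC -mulrBl => /eqP.
rewrite mulf_eq0 (negPf c0) orbF subr_eq0 => /eqP r0E.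
have := tform_csa_diag hd; rewrite r0E mulr_natl mulr2n => /eqP.
by rewrite -subr_eq0 addrK.
Qed.

(** Dually, take [gamma] maximal and pair with [x_gamma]: now only the summand
    [r0] contributes, and [r0(h_gamma, h_gamma) = 0]. *)
Lemma positive_part0 : {in pos, forall gamma, B X (x gamma) = 0}.
Proof.
have [rank rankP] := bd_prec_rank T.
apply: (rank_ind (rank := rank)) => gamma pg IH.
have [rg _ _ _] := posP pg; have [xg xNg x1] := root_vectorP x_root rg.
apply: contraTeq (dual_norm_neq0 pg) => c0; rewrite negbK.
set c := B X _ in c0.
have hd := form_dual_csa gamma; set H := dual gamma in hd *.
have := fixX H (x gamma).
rewrite (tform_rmatrix_csa _ hd).
rewrite (tform_csa (phi' := B H) (psi' := - c *: B H)) //; last first.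
  by move=> H' hH'; rewrite (form_lie_root hH' xg) scale_lfunE scaleNr.
rewrite (linZ (tform_linearr _ _)).
have -> : tform r (B (lie X H)) (B (x gamma)) = 0.
  rewrite tform_rmatrix tform_csa0r; last exact/form_root_csa0.
  rewrite !big_seq !big1 ?addr0 // => alpha pa; last first.
    by rewrite (form_pos0 x_root pg pa) mulr0.
  have [ra _ _ _] := posP pa.
  rewrite big_seq_cond big1 // => beta /andP[pb /asboolP ab].
  have [rb _ _ _] := posP pb; have [xb _ _] := root_vectorP x_root rb.
  rewrite (form_pos0 x_root pg pb) mulr0 sub0r (form_root_vectors x_root) //.
  case: eqVneq => [ga|_]; last by rewrite mulr0 oppr0.
  by rewrite (form_lie_csa hd xb) IH ?mulr0 ?mul0r ?oppr0 // rankP // ga.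
rewrite add0r [_ *: _]mulrC => /eqP.
rewrite mulf_eq0 oppr_eq0 (negPf c0) orbF => /eqP r0E.
by rewrite -tform_csa_diag // r0E mulr0.
Qed.

Lemma fixes_rmatrix_csa : X \in h.
Proof.
apply: (csa_of_orthogonal x_root) => alpha pa.
by rewrite positive_part0 // negative_part0.
Qed.

(** The value of [r] at [x_alpha] and [x_(-tau alpha)] is the coefficient [1] of
    the pair [alpha < tau alpha], plus [1] from the diagonal sum if [tau] fixes
    [alpha]; in any case it is not zero. *)
Lemma fixes_rmatrix_tau : {in dom, forall alpha, ev alpha X = ev (tau alpha) X}.
Proof.
move=> alpha da; have hX := fixes_rmatrix_csa.
have pa : alpha \in pos by apply/simple_pos/(bd_dom_simple da).
have pb : tau alpha \in pos by apply/simple_pos/tau_simple.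
have [ra _ _ _] := posP pa; have [xa _ _] := root_vectorP x_root ra.
have [rb _ _ _] := posP pb; have [_ xNb _] := root_vectorP x_root rb.
have := fixX (x alpha) (x (- tau alpha)).
rewrite (lie_weight xa) // (lie_weight xNb) // !linearZ /= csa_evalN.
rewrite (linZ (tform_linearl _ _)) (linZ (tform_linearr _ _)).
have -> : tform r (B (x alpha)) (B (x (- tau alpha))) =
    (1 + (alpha == tau alpha))%:R.
  rewrite tform_rmatrix tform_csa0l; last exact/form_root_csa0.
  rewrite add0r natrD addrC; congr (_ + _).
    rewrite (bigD1_seq alpha) ?pos_uniq //= [X in _ + X]big_seq_cond.
    rewrite [X in _ + X]big1 => [|beta /andP[pb' ba]]; last first.
      have [rb' _ _ _] := posP pb'; rewrite big_seq_cond big1 // => beta'.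
      move=> /andP[/(form_pos0 x_root pa) -> _].
      by rewrite (form_root_vectors x_root) // eq_sym (negPf ba) !mul0r subrr.
    rewrite addr0 -big_filter (bigD1_seq (tau alpha)) /=; last first.
    - by rewrite filter_uniq ?pos_uniq.
    - by rewrite mem_filter pb andbT; apply/asboolP/tau_prec.
    rewrite big_filter_cond big_seq_cond big1 => [|beta].
      rewrite (form_pos0 x_root pa pb) mul0r subr0 addr0.
      rewrite !(form_root_vectors x_root) // eqxx mul1r.
      by rewrite (form_sym (rd_formP rd)) (form_root_vectors x_root) // eqxx.
    case/and3P=> pb' _ bt; have [rb' _ _ _] := posP pb'.
    rewrite (form_pos0 x_root pa pb') mul0r subr0.
    rewrite (form_sym (rd_formP rd) (x (- tau alpha))).
    by rewrite (form_root_vectors x_root rb' rb) (negPf bt) mulr0.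
  rewrite (bigD1_seq alpha) ?pos_uniq //= big_seq_cond.
  rewrite big1 => [|beta]; last first.
    case/andP=> pb' ba; have [rb' _ _ _] := posP pb'.
    by rewrite (form_root_vectors x_root) // eq_sym (negPf ba) mul0r.
  rewrite addr0 (form_root_vectors x_root) // eqxx mul1r.
  by rewrite (form_sym (rd_formP rd)) (form_root_vectors x_root).
rewrite -mulrDl => /eqP; rewrite mulf_eq0 pnatr_eq0 orbF => /eqP.
by move/eqP; rewrite subr_eq0 => /eqP.
Qed.

End Fixed.

(** No pair is comparable when the triple is empty, and the other summands of
    the r-matrix have weight zero. *)
Lemma csa_fixes_rmatrix H : dom = [::] -> H \in h -> tad H r = 0.
Proof.
move=> dom0 hH; have lin_tad : linear (tad H) by apply: tlift_linear.
have [abel _ _] := rd_csaP rd.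
have tad_pure y z : tad H (pure y z) = pure (lie H y) z + pure y (lie H z).
  by apply: tder_pure; apply: lie_linearr.
rewrite /bd_rmatrix !(linD lin_tad) csa_tens_sum !(lin_sum lin_tad).
rewrite big1 => [|i _]; last first.
  rewrite (lin_sum lin_tad) big1 // => j _; rewrite (linZ lin_tad) tad_pure.
  rewrite !abel ?subvsP // (lin0 (pure_linearl _)) (lin0 (pure_linearr _)).
  by rewrite addr0 scaler0.
rewrite big_seq big1 => [|alpha pa]; last first.
  have [ra _ _ _] := posP pa; have [xa xNa _] := root_vectorP x_root ra.
  rewrite tad_pure (lie_weight xa) // (lie_weight xNa) // csa_evalN.
  rewrite (linZ (pure_linearl _)) (linZ (pure_linearr _)).
  by rewrite scaleNr addNr.
rewrite big_seq big1 ?addr0 // => alpha pa; rewrite big1 ?(lin0 lin_tad) //.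
move=> beta /asboolP[[_ [k aE]] _ _]; have [_ /eqP[]] := posP pa.
by rewrite aE dom0 big_nil.
Qed.

End RMatrix.

(** * Biderivations *)

Section ClosedField.
Variables (K : numClosedFieldType) (g : lieAlgType K) (rd : root_datum g).
Local Notation h := (rd_csa rd).
Variable T : bd_triple rd.
Variables (r0 : tens (subvs_of h) (subvs_of h)) (x : csa_dual h -> g).
Local Notation r := (bd_rmatrix T r0 x).

Lemma center_eq0 X : (forall y : g, lie X y = 0) -> X = 0.
Proof.
move=> X0; have hX : X \in h.
  rewrite -(weight0 rd); apply/root_spaceP => H hH.
  by rewrite lieC X0 oppr0 csa_eval0 scale0r.
apply: (@csa_eq0 _ _ rd) => // gamma; rewrite -vpick0 => z0.
have := lie_weight (memv_pick (root_space gamma)) hX; rewrite X0 => /esym/eqP.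
by rewrite scaler_eq0 (negPf z0) orbF => /eqP.
Qed.

Lemma ad_inj : injective (@ad K g).
Proof.
move=> X Y adXY; apply/eqP; rewrite -subr_eq0; apply/eqP/center_eq0 => y.
by rewrite lieDl lieNl -!adE adXY subrr.
Qed.

Lemma biderivation_csa (D : 'End(g)) :
    continuous_parameter T r0 -> root_vectors x -> derivation D ->
    (forall y, tder D (tad y r) = tad (D y) r) ->
    (forall y, tswap (tad y r) = - tad y r) ->
  exists X, [/\ X \in h, D = ad X
    & {in bd_dom T, forall alpha,
        csa_eval alpha X = csa_eval (bd_tau T alpha) X}].
Proof.
move=> r0P xP derD codD skew; have [X DE] := derivation_inner rd derD.
have fixX : fixes_rmatrix T r0 x X.
  apply: biderivation_fixes_rmatrix (skew X) => y.
  by rewrite -adE -DE -codD DE -tad_ad.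
exists X; split=> //; first exact: (fixes_rmatrix_csa r0P xP fixX).
exact: (fixes_rmatrix_tau r0P xP fixX).
Qed.

Lemma csa_coderivation H y : root_vectors x -> bd_dom T = [::] -> H \in h ->
  tder (ad H) (tad y r) = tad (lie H y) r.
Proof.
move=> xP dom0 hH; rewrite -tad_ad tad_lie (csa_fixes_rmatrix _ xP dom0 hH).
by rewrite /tad /tder (lin0 (tlift_linear _)) addr0.
Qed.

End ClosedField.

(** * Complexification *)

Section Complexification.
Variable R : rcfType.

Section Space.
Variable V : vectType R.
Implicit Types (v w : V) (s t : tens V V).

Lemma cplx_inj_linear (a : R) v w :
  cplx_inj (a *: v + w) = a%:C%C *: cplx_inj v + cplx_inj w.
Proof.
by congr pair; rewrite /= ?scale0r ?scaler0 ?subr0 ?addr0.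
Qed.

Lemma cplx_tens_linear (a : R) s t :
  cplx_tens (a *: s + t) = a%:C%C *: cplx_tens s + cplx_tens t.
Proof.
rewrite /cplx_tens scaler_sumr -big_split; apply: eq_bigr => i _ /=.
rewrite scaler_sumr -big_split; apply: eq_bigr => j _ /=.
by rewrite !mxE rmorphD rmorphM scalerDl scalerA.
Qed.

Lemma cplx_tens0 : cplx_tens (0 : tens V V) = 0.
Proof.
rewrite /cplx_tens big1 // => i _; rewrite big1 // => j _.
by rewrite mxE rmorph0 scale0r.
Qed.

Lemma cplx_tensD s t : cplx_tens (s + t) = cplx_tens s + cplx_tens t.
Proof. by rewrite -[s]scale1r cplx_tens_linear rmorph1 !scale1r. Qed.

Lemma cplx_tensN t : cplx_tens (- t) = - cplx_tens t.
Proof.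
rewrite -[- t]addr0 -scaleN1r cplx_tens_linear cplx_tens0 addr0.
by rewrite rmorphN1 scaleN1r.
Qed.

Lemma cplx_tensZ a t : cplx_tens (a *: t) = a%:C%C *: cplx_tens t.
Proof. by rewrite -[a *: t]addr0 cplx_tens_linear cplx_tens0 addr0. Qed.

Lemma cplx_tens_sum I (l : seq I) (E : I -> tens V V) :
  cplx_tens (\sum_(i <- l) E i) = \sum_(i <- l) cplx_tens (E i).
Proof.
elim: l => [|i l IHl]; first by rewrite !big_nil cplx_tens0.
by rewrite !big_cons cplx_tensD IHl.
Qed.

Lemma cplx_inj_sum I (l : seq I) (a : I -> R) (E : I -> V) :
  cplx_inj (\sum_(i <- l) a i *: E i) =
  \sum_(i <- l) (a i)%:C%C *: cplx_inj (E i).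
Proof.
elim: l => [|i l IHl]; first by rewrite !big_nil.
by rewrite !big_cons cplx_inj_linear IHl.
Qed.

Lemma cplx_tens_pure v w :
  cplx_tens (pure v w) = pure (cplx_inj v) (cplx_inj w).
Proof.
rewrite {2}(coord_vbasis (memvf v)) {2}(coord_vbasis (memvf w)) !cplx_inj_sum.
rewrite (lin_sum (pure_linearl _)); apply: eq_bigr => i _.
rewrite (lin_sum (pure_linearr _)); apply: eq_bigr => j _.
rewrite (linZ (pure_linearl _)) (linZ (pure_linearr _)) scalerA mxE.
by rewrite rmorphM.
Qed.

(** A real tensor is determined by its complexification because the real
    coordinates extend to complex coordinates. *)
Lemma cplx_tens_inj : injective (@cplx_tens R V).
Proof.
move=> s t st; apply/eqP; rewrite -subr_eq0; apply/eqP.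
have : cplx_tens (s - t) = 0 by rewrite cplx_tensD cplx_tensN st subrr.
move: (s - t) => {}t {s st} t0; apply/matrixP => k l; rewrite mxE.
pose phi (k : 'I_(\dim {:V})) (v : cplx V) : R[i]^o := cplx_coord v 0 k.
have lin_phi k' : linear (phi k').
  move=> a v w; rewrite /phi !mxE /= !linearD /= linearN /= !linearZ /=.
  by apply/eqP; rewrite eq_complex; case: a => a b /=; rewrite !eqxx.
have phiE k' (j : 'I_(\dim {:V})) :
    phi k' (cplx_inj (vbasis {:V})`_j) = (j == k')%:R.
  rewrite /phi mxE /= coord_free ?(basis_free (vbasisP _)) // linear0.
  by case: eqP.
pose F (u : tens (cplx V) (cplx V)) : R[i]^o :=
  tlift (fun v w : cplx V => phi k v * phi l w : R[i]^o) u.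
have FE (v w : cplx V) : F (pure v w) = phi k v * phi l w.
  rewrite /F tliftE // => u a y z; rewrite lin_phi.
    by rewrite mulrDl -scalerAl.
  by rewrite mulrDr -scalerAr.
have lin_F : linear F by apply: tlift_linear.
have := congr1 F t0; rewrite (lin0 lin_F) /cplx_tens (lin_sum lin_F).
rewrite (bigD1 k) //= (lin_sum lin_F) (bigD1 l) //= !big1 ?addr0.
- rewrite (linZ lin_F) FE !phiE !eqxx mulr1 => /(congr1 (@complex.Re R)) /=.
  by rewrite mulr1 mulr0 subr0.
- move=> i ik; rewrite (lin_sum lin_F) big1 // => j _.
  by rewrite (linZ lin_F) FE !phiE (negPf ik) mul0r scaler0.
- by move=> j jl; rewrite (linZ lin_F) FE !phiE (negPf jl) mulr0 scaler0.
Qed.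

Lemma cplx_tens_tswap t : cplx_tens (tswap t) = tswap (cplx_tens t).
Proof.
have lin_sw : linear (@tswap _ (cplx V) (cplx V)) by apply: tlift_linear.
rewrite {1}/tswap /tlift {2}/cplx_tens cplx_tens_sum (lin_sum lin_sw).
apply: eq_bigr => i _; rewrite cplx_tens_sum (lin_sum lin_sw).
apply: eq_bigr => j _.
by rewrite cplx_tensZ cplx_tens_pure (linZ lin_sw) tswap_pure.
Qed.

Section Endomorphism.
Variable D : 'End(V).

Definition cplx_end : 'End(cplx V) :=
  linfun (fun v : cplx V => (D v.1, D v.2) : cplx V).

Lemma cplx_endE (v : cplx V) : cplx_end v = (D v.1, D v.2).
Proof.
rewrite linfunE // => a {}v w; congr pair;
  by rewrite /= !linearD /= ?linearN /= !linearZ.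
Qed.

Lemma cplx_end_inj v : cplx_end (cplx_inj v) = cplx_inj (D v).
Proof. by rewrite cplx_endE /= linear0. Qed.

Lemma cplx_tens_tder t : cplx_tens (tder D t) = tder cplx_end (cplx_tens t).
Proof.
have lin_D : linear (tder cplx_end) by apply: tlift_linear.
rewrite {1}/tder /tlift {2}/cplx_tens cplx_tens_sum (lin_sum lin_D).
apply: eq_bigr => i _; rewrite cplx_tens_sum (lin_sum lin_D).
apply: eq_bigr => j _; rewrite cplx_tensZ cplx_tensD !cplx_tens_pure.
rewrite (linZ lin_D) tder_pure; last exact: linearP.
by rewrite !cplx_end_inj.
Qed.

End Endomorphism.
End Space.

Section Lie.
Variable g : lieAlgType R.
Implicit Types (D : 'End(g)) (delta : 'Hom(g, tens g g)) (v w : cplx g).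

Lemma cplx_lieE v w :
  lie v w = (lie v.1 w.1 - lie v.2 w.2, lie v.1 w.2 + lie v.2 w.1).
Proof. by []. Qed.

Lemma cplx_end_ad (H : g) : cplx_end (ad H) = ad (cplx_inj H).
Proof.
apply/lfunP => v; rewrite cplx_endE !adE cplx_lieE /= !lie0l.
by rewrite subr0 addr0.
Qed.

Lemma cplx_end_derivation D : derivation D -> derivation (cplx_end D).
Proof.
move=> derD v w; rewrite !cplx_endE !cplx_lieE /= linearB linearD /= !derD.
by congr pair; rewrite ?opprD addrACA.
Qed.

Lemma cplx_cobracket_inj delta (y : g) :
  cplx_cobracket delta (cplx_inj y) = cplx_tens (delta y).
Proof. by rewrite /cplx_cobracket /= linear0 cplx_tens0 scaler0 addr0. Qed.

Lemma cplx_cobracket_tder delta D v :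
  (forall y, tder D (delta y) = delta (D y)) ->
  tder (cplx_end D) (cplx_cobracket delta v)
  = cplx_cobracket delta (cplx_end D v).
Proof.
move=> codD; have lin_D : linear (tder (cplx_end D)) by apply: tlift_linear.
rewrite /cplx_cobracket (linD lin_D) (linZ lin_D) -!cplx_tens_tder !codD.
by rewrite cplx_endE.
Qed.

Lemma cplx_cobracket_tswap delta v :
  (forall y, tswap (delta y) = - delta y) ->
  tswap (cplx_cobracket delta v) = - cplx_cobracket delta v.
Proof.
move=> skew.
have lin_sw : linear (@tswap _ (cplx g) (cplx g)) by apply: tlift_linear.
rewrite /cplx_cobracket (linD lin_sw) (linZ lin_sw) -!cplx_tens_tswap !skew.
by rewrite !cplx_tensN scalerN opprD.
Qed.

End Lie.
End Complexification.

Theorem theorem2p11 (R : realType) :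
  (* K = C *)
  (forall (g : lieAlgType R[i]) (delta : 'Hom(g, tens g g))
      (rd : root_datum g) (T : bd_triple rd)
      (r0 : tens (subvs_of (rd_csa rd)) (subvs_of (rd_csa rd)))
      (x : csa_dual (rd_csa rd) -> g),
    semisimple g -> lie_bialgebra delta -> factorizable delta ->
    continuous_parameter T r0 -> root_vectors x ->
    (forall v : g, delta v = tad v (bd_rmatrix T r0 x)) ->
    (forall D : 'End(g), biderivation delta D ->
       (exists! H : g, H \in rd_csa rd /\ D = ad H) /\
       (forall H : g, H \in rd_csa rd -> D = ad H ->
          forall alpha, alpha \in bd_dom T ->
            csa_eval alpha H = csa_eval (bd_tau T alpha) H)) /\
    (bd_dom T = [::] ->
       (forall H : g, H \in rd_csa rd -> biderivation delta (ad H)) /\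
       (forall D : 'End(g), biderivation delta D ->
          exists2 H : g, H \in rd_csa rd & D = ad H)))
  /\
  (* K = R *)
  (forall (g : lieAlgType R) (delta : 'Hom(g, tens g g))
      (rd : root_datum (cplx g)) (T : bd_triple rd)
      (r0 : tens (subvs_of (rd_csa rd)) (subvs_of (rd_csa rd)))
      (x : csa_dual (rd_csa rd) -> cplx g),
    semisimple g -> lie_bialgebra delta ->
    factorizable delta \/ almost_factorizable delta ->
    continuous_parameter T r0 -> root_vectors x ->
    (forall v : cplx g,
       cplx_cobracket delta v = tad v (bd_rmatrix T r0 x)) ->
    (forall D : 'End(g), biderivation delta D ->
       (exists! H : g, cplx_inj H \in rd_csa rd /\ D = ad H) /\
       (forall H : g, cplx_inj H \in rd_csa rd -> D = ad H ->
          forall alpha, alpha \in bd_dom T ->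
            csa_eval alpha (cplx_inj H) =
            csa_eval (bd_tau T alpha) (cplx_inj H))) /\
    (bd_dom T = [::] ->
       (forall H : g, cplx_inj H \in rd_csa rd ->
          biderivation delta (ad H)) /\
       (forall D : 'End(g), biderivation delta D ->
          exists2 H : g, cplx_inj H \in rd_csa rd & D = ad H))).
Proof.
split.
  move=> g delta rd T r0 x _ [skew _ _] _ r0P xP deltaE.
  have bider D : biderivation delta D -> exists X, [/\ X \in rd_csa rd, D = ad X
      & {in bd_dom T, forall alpha,
          csa_eval alpha X = csa_eval (bd_tau T alpha) X}].
    case=> derD codD; apply: biderivation_csa (r0P) (xP) derD _ _ => y.
      by rewrite -!deltaE codD.
    by rewrite -!deltaE skew.
  split=> [D /bider[X [hX DE tauX]]|dom0].
    split; last by move=> H _; rewrite DE => /(ad_inj rd) <-.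
    by exists X; split=> // H [_]; rewrite DE => /(ad_inj rd).
  split=> [H hH|D /bider[X [hX DE _]]]; last by exists X.
  split=> [|v]; first exact: derivation_ad.
  by rewrite !deltaE adE csa_coderivation.
move=> g delta rd T r0 x _ [skew _ _] _ r0P xP deltaE.
have bider D : biderivation delta D -> exists X, [/\ cplx_inj X \in rd_csa rd,
    D = ad X & {in bd_dom T, forall alpha,
      csa_eval alpha (cplx_inj X) = csa_eval (bd_tau T alpha) (cplx_inj X)}].
  case=> derD codD.
  have [|||y|y|[X1 X2] [hX DE tauX]] :=
    @biderivation_csa _ _ _ T r0 x (cplx_end D).
  - exact: r0P.
  - exact: xP.
  - exact: cplx_end_derivation.
  - by rewrite -!deltaE cplx_cobracket_tder.
  - by rewrite -!deltaE cplx_cobracket_tswap.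
  have DX y : D y = lie X1 y /\ lie X2 y = 0.
    have := congr1 (fun E : 'End(cplx g) => E (cplx_inj y)) DE.
    rewrite cplx_end_inj adE cplx_lieE /= !(lin0 (lie_linearr _)) subr0 add0r.
    by move=> [-> <-].
  (* [X2] commutes with the real form, hence is central. *)
  have X20 : X2 = 0.
    suff: cplx_inj X2 = 0 by move=> [].
    apply: (center_eq0 rd) => -[y z]; rewrite cplx_lieE /= !lie0l.
    by rewrite !(proj2 (DX _)) subr0 addr0.
  exists X1; rewrite -[cplx_inj X1]/(X1, 0) -X20; split=> //.
  by apply/lfunP => y; rewrite adE; case: (DX y).
have inj_ad (H H' : g) : ad H = ad H' -> H = H'.
  move=> adHH'; have := congr1 (fun E : 'End(g) => cplx_end E) adHH'.
  by rewrite !cplx_end_ad => /(ad_inj rd)[].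
split=> [D /bider[X [hX DE tauX]]|dom0].
  split; last by move=> H _; rewrite DE => /inj_ad <-.
  by exists X; split=> // H [_]; rewrite DE => /inj_ad.
split=> [H hH|D /bider[X [hX DE _]]]; last by exists X.
split=> [|y]; first exact: derivation_ad.
apply: cplx_tens_inj; rewrite cplx_tens_tder -!cplx_cobracket_inj !deltaE.
rewrite cplx_end_ad (csa_coderivation r0 _ xP dom0 hH).
by rewrite -cplx_end_inj cplx_end_ad adE.
Qed.
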